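(* Let $T$ be a connected semi-Riemannian manifold, $j:B\hookrightarrow N$ a connected lightlike submanifold of the semi-Riemannian manifold $(N,h)$ such that the induced metric $j^*h$ is $\rho$-lightlike, and $\tilde B$ the universal covering manifold of $B$. Let $\varphi:\pi_1(B,x_0)\to \mathrm{Isom}(T)$ be a group homomorphism and let $\hat M=T\times_f\tilde B$ be a warped product with a $G$-invariant warping function $f:T\to(0,+\infty)$, where $G=\varphi(\pi_1(B,x_0))$. Let $M=\hat M/\pi_1(B,x_0)$. Then the foliation $\mathcal F$ of $M$ defined by suspension of the homomorphism $\varphi$ is tangentially lightlike and $g$ is a $\rho$-lightlike metric in $T(\mathcal F)$, where $g$ denotes the metric induced in $T(\mathcal F)$ by the metric $g$ in $T(M)$ with $\pi^*g=\hat g$.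
   Context: A (bundle) metric in a real vector bundle $E\to M$ of rank $k$ is a $C^\infty$ section $g$ of $E^*\otimes E^*$ with each $g_x$ symmetric and of constant index; it may be degenerate. It is semi-Riemannian if each $g_x$ is nondegenerate and the index $\sigma$ satisfies $1\le\sigma\le k-1$. Its radical is $(\mathrm{Rad}\,E)_x=\{v\in E_x: g_x(v,w)=0\ \forall w\in E_x\}$. The metric is called $r$-lightlike if $\mathrm{Rad}\,E$ is a subbundle of $E$ of rank $r$ with $1\le r\le k$. If $\mathcal F$ is a foliation of codimension $q$ of an $n$-dimensional manifold $M$, $m=n-q$, and $g$ is an $r$-lightlike metric in the tangent bundle $T(\mathcal F)$ of $\mathcal F$, where $1\le r\le\min\{m,q\}$, then $(\mathcal F,g)$ is called a tangentially lightlike foliation of $M$. A lightlike submanifold $j:B\hookrightarrow N$ of a semi-Riemannian manifold $(N,h)$, with $\dim B=m$ and $\dim N=m+\ell$, is one for which the radical of $g_B=j^*h$ in $T(B)$ has constant dimension $\rho$ with $1\le\rho\le\min\{m,\ell\}$. Fix $x_0\in B$, let $\tilde p:\tilde B\to B$ be the universal covering and $g_{\tilde B}=\tilde p^*g_B$. Let $g_T$ be the semi-Riemannian metric of $T$, $q=\dim T$, and $\mathrm{Isom}(T)$ the isometry group of $(T,g_T)$. The warped product $\hat M=T\times_f\tilde B$ (with $f:T\to(0,+\infty)$ of class $C^\infty$) is the product manifold $T\times\tilde B$ endowed with the (degenerate) $(0,2)$-tensor field $\hat g=p_1^*g_T+(f\circ p_1)^2p_2^*g_{\tilde B}$, where $p_1:\hat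 M\to T$ and $p_2:\hat M\to\tilde B$ are the projections. The group $\pi_1(B,x_0)$ acts on $\tilde B$ on the right by deck transformations $\tilde x\mapsto\tilde x\cdot[\gamma]$, and on $\hat M$ by $R_{[\gamma]}(y,\tilde x)=(\varphi([\gamma]^{-1})(y),\tilde x\cdot[\gamma])$. The quotient $M=\hat M/\pi_1(B,x_0)$ is a $C^\infty$ manifold and the projection $\pi:\hat M\to M$ is étale (a local diffeomorphism). Let $\hat{\mathcal F}$ be the foliation of $\hat M$ with leaves $\{y\}\times\tilde B$, $y\in T$. The foliation $\mathcal F$ of $M$ defined by suspension of $\varphi$ is the one whose leaves are the images $\pi(L)$ of the leaves $L$ of $\hat{\mathcal F}$. Since $G\subset\mathrm{Isom}(T)$ and $f$ is $G$-invariant, $\hat g$ is $\pi_1(B,x_0)$-invariant and there is a (possibly degenerate) metric $g$ in $T(M)$ with $\pi^*g=\hat g$; the same symbol $g$ denotes the induced metric in $T(\mathcal F)$.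
   Formalization: That F is tangentially lightlike is asserted only when ρ ≤ q = dim T, since the definition requires ρ ≤ min{m,q} and the hypotheses give only ρ ≤ min{m,ℓ}; that F is a foliation and that g is ρ-lightlike in T(F) are asserted unconditionally. *)

(* Defs.v *)
From HB Require Import structures.
From mathcomp Require Export all_boot all_order all_algebra.
From mathcomp Require Import ring lra.
From mathcomp Require Export all_classical all_reals topology normedtype landau derive.
Set Implicit Arguments.
Unset Strict Implicit.
Unset Printing Implicit Defensive.
Import Order.TTheory GRing.Theory Num.Theory.
Import numFieldTopology.Exports numFieldNormedType.Exports.
Local Open Scope classical_set_scope.
Local Open Scope ring_scope.

Section Smooth.
Context {R : realType}.

(* Meant for U open in a finite-dimensional V: f is C^(k+1) when it is
   differentiable and each of its directional derivatives is C^k. *)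
Fixpoint Ck (V W : normedModType R) (k : nat) (U : set V) (f : V -> W) : Prop :=
  match k with
  | 0 => forall x, U x -> {for x, continuous f}
  | k'.+1 => (forall x, U x -> differentiable f x) /\
             forall v, Ck k' U (fun x => 'd f x v)
  end.

Definition Coo (V W : normedModType R) (U : set V) (f : V -> W) :=
  forall k, Ck k U f.

Lemma near_eq_diff (V W : normedModType R) (f g : V -> W) (x : V) :
  (\forall y \near x, f y = g y) -> differentiable f x ->
  differentiable g x /\ 'd g x = 'd f x :> (V -> W).
Proof.
move=> fg df; pose h := g - f.
have h0 : h \o shift x = cst (h x) + cst 0 +o_ 0 id.
  apply: eqaddoE; apply/eqaddoP => e e0.
  have nx : \forall y \near (0:V), h (y + x) = 0.
    have : (fun y => y + x) @ (0:V) --> x.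
      rewrite -[X in _ --> X]add0r; apply: cvgD; [exact: cvg_id|exact: cvg_cst].
    move=> /(_ _ fg); rewrite /= nbhs_simpl /=.
    by apply: filterS => y /= e1; rewrite /h !fctE e1 subrr.
  apply: filterS nx => y hy.
  rewrite !fctE /= hy {1}/h !fctE (nbhs_singleton fg) subrr addr0 subrr normr0.
  by rewrite mulr_ge0 // ltW.
have c0 : continuous (\0 : {linear V -> W}) by move=> ?; exact: cvg_cst.
have dh0 : 'd h x = (\0 : {linear V -> W}) :> (V -> W).
  exact: diff_unique.
have dh : differentiable h x.
  apply/diff_locallyP; rewrite dh0; split => //.
have -> : g = f + h by rewrite /h addrCA subrr addr0.
split; first exact: differentiableD.
apply: etrans (diffD df dh) _; apply/funext => v.
have e0 : 'd h x v = 0 by have := congr1 (fun k => k v) dh0.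
by rewrite -[LHS]/('d f x v + 'd h x v) e0 addr0.
Qed.

Lemma Ck_ext (V W : normedModType R) k (U : set V) (f g : V -> W) :
  open U -> (forall x, U x -> f x = g x) -> Ck k U f -> Ck k U g.
Proof.
move=> oU; elim: k f g => [|k IH] f g fg /=.
  move=> cf x Ux; have nU : \forall y \near x, f y = g y.
    by apply: filterS (open_nbhs_nbhs (conj oU Ux)) => y; exact: fg.
  rewrite /prop_for /continuous_at -(fg _ Ux).
  by apply: cvg_trans (cf x Ux); exact: near_eq_cvg.
move=> [df Df]; have nE x : U x -> differentiable g x /\ 'd g x = 'd f x :> (V -> W).
  move=> Ux; apply: near_eq_diff (df x Ux).
  by apply: filterS (open_nbhs_nbhs (conj oU Ux)) => y; exact: fg.
split; first by move=> x /nE[].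
by move=> v; apply: IH (Df v) => x Ux; have [_ ->] := nE x Ux.
Qed.

Section RowMx.
Variables (n1 n2 : nat).

Lemma row_mx_cvg (X : topologicalType) (f : X -> 'rV[R]_n1) (g : X -> 'rV[R]_n2) x :
  {for x, continuous f} -> {for x, continuous g} ->
  {for x, continuous (fun y => row_mx (f y) (g y))}.
Proof.
move=> cf cg; apply/cvg_ballP => e e0.
move/cvg_ballP : cf => /(_ _ e0) cf; move/cvg_ballP : cg => /(_ _ e0) cg.
apply: filterS2 cf cg => y [_ hf] [_ hg]; split=> // i j; rewrite !mxE.
by case: splitP => k _; [exact: hf|exact: hg].
Qed.

Lemma row_mx_linl : linear (fun a : 'rV[R]_n1 => row_mx a (0 : 'rV[R]_n2)).
Proof. by move=> a u v; rewrite scale_row_mx add_row_mx scaler0 addr0. Qed.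
Lemma row_mx_linr : linear (fun b : 'rV[R]_n2 => row_mx (0 : 'rV[R]_n1) b).
Proof. by move=> a u v; rewrite scale_row_mx add_row_mx scaler0 addr0. Qed.

Definition rowl : {linear 'rV[R]_n1 -> 'rV[R]_(n1 + n2)} :=
  HB.pack (fun a : 'rV[R]_n1 => row_mx a (0 : 'rV[R]_n2))
    (GRing.isLinear.Build _ _ _ _ _ row_mx_linl).
Definition rowr : {linear 'rV[R]_n2 -> 'rV[R]_(n1 + n2)} :=
  HB.pack (fun b : 'rV[R]_n2 => row_mx (0 : 'rV[R]_n1) b)
    (GRing.isLinear.Build _ _ _ _ _ row_mx_linr).

Lemma rowl_cont : continuous rowl.
Proof.
by move=> x; apply: (@row_mx_cvg _ id (fun=> 0) x); [move=> ?; exact|exact: cst_continuous].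
Qed.
Lemma rowr_cont : continuous rowr.
Proof.
by move=> x; apply: (@row_mx_cvg _ (fun=> 0) id x); [exact: cst_continuous|move=> ?; exact].
Qed.

Lemma lin_comp_diff (U V W Z : normedModType R) (a : {linear U -> V})
    (b : {linear W -> Z}) (f : V -> W) x :
  continuous a -> continuous b -> differentiable f (a x) ->
  differentiable (b \o (f \o a)) x /\
  forall v, 'd (b \o (f \o a)) x v = b ('d f (a x) (a v)).
Proof.
move=> ca cb df; have da : differentiable a x by exact: linear_differentiable.
have dfa : differentiable (f \o a) x by exact: differentiable_comp.
have db : differentiable b ((f \o a) x) by exact: linear_differentiable.
split; first exact: differentiable_comp.
move=> v; rewrite (diff_comp dfa db) /= (diff_lin _ cb).
by rewrite (diff_comp da df) /= (diff_lin _ ca).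
Qed.

Lemma Ck_prod (m1 m2 k : nat) (A : set 'rV[R]_m1) (B : set 'rV[R]_m2)
    (W : set 'rV[R]_(m1 + m2)) (f : 'rV[R]_m1 -> 'rV[R]_n1) (g : 'rV[R]_m2 -> 'rV[R]_n2) :
  open W -> (forall u, W u -> A (lsubmx u) /\ B (rsubmx u)) ->
  Ck k A f -> Ck k B g ->
  Ck k W (fun u => row_mx (f (lsubmx u)) (g (rsubmx u))).
Proof.
move=> oW WAB; elim: k f g => [|k IH] f g /=.
  move=> cf cg u /WAB[Au Bu]; apply: row_mx_cvg.
    by apply: continuous_comp; [exact: continuous_lsubmx|exact: cf].
  by apply: continuous_comp; [exact: continuous_rsubmx|exact: cg].
move=> [df Df] [dg Dg]; set F := fun u => _.
have FE : F = (rowl \o (f \o lsubmx)) + (rowr \o (g \o rsubmx)).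
  by apply/funext => u; rewrite /F !fctE /= add_row_mx addr0 add0r.
have dF u : W u -> differentiable F u /\ forall v,
    'd F u v = row_mx ('d f (lsubmx u) (lsubmx v)) ('d g (rsubmx u) (rsubmx v)).
  move=> /WAB[/df dfu /dg dgu].
  have [d1 e1] := @lin_comp_diff _ _ _ _ (lsubmx : {linear 'rV[R]_(m1 + m2) -> 'rV_m1})
    rowl f u (@continuous_lsubmx R 1 m1 m2) rowl_cont dfu.
  have [d2 e2] := @lin_comp_diff _ _ _ _ (rsubmx : {linear 'rV[R]_(m1 + m2) -> 'rV_m2})
    rowr g u (@continuous_rsubmx R 1 m1 m2) rowr_cont dgu.
  rewrite FE; split; first exact: differentiableD.
  by move=> v; rewrite (diffD d1 d2); apply: etrans (congr2 +%R (e1 v) (e2 v)) _;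
  rewrite /= add_row_mx addr0 add0r.
split=> [u /dF[]//|v].
apply: (Ck_ext oW) (IH _ _ (Df (lsubmx v)) (Dg (rsubmx v))) => u Wu.
by have [_ ->] := dF u Wu.
Qed.

End RowMx.
End Smooth.

Section Chart.
Context {R : realType}.

(* The values of cmap off cdom and of cinv off the image of cdom are junk. *)
Record chart (X : topologicalType) (n : nat) := Chart {
  cdom : set X;
  cmap :> X -> 'rV[R]_n;
  cinv : 'rV[R]_n -> X;
  open_cdom : open cdom;
  open_cimg : open (cmap @` cdom);
  cmapK : forall x, cdom x -> cinv (cmap x) = x;
  cmap_cont : forall x, cdom x -> {for x, continuous cmap};
  cinv_cont : forall u, (cmap @` cdom) u -> {for u, continuous cinv} }.

Definition transition (X : topologicalType) n (c d : chart X n) :=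
  Coo (c @` (cdom c `&` cdom d)) (d \o cinv c).

Lemma chart_open (X : topologicalType) n (c : chart X n) (V : set X) :
  open V -> V `<=` cdom c -> open (c @` V).
Proof.
move=> oV Vc; rewrite openE => _ [x Vx <-].
have cx : (c @` cdom c) (c x) by exists x => //; exact: Vc.
have nV : nbhs (cinv c (c x)) V by rewrite cmapK; [exact: open_nbhs_nbhs|exact: Vc].
have := cinv_cont cx nV; rewrite nbhs_simpl /= => h1.
have h2 := open_nbhs_nbhs (conj (@open_cimg _ _ c) cx).
apply: filterS2 h1 h2 => u /= Vu [y cy uE].
by exists y => //; rewrite -uE cmapK // in Vu.
Qed.

Section ProdChart.
Context (X Y : topologicalType) (n1 n2 : nat) (c : chart X n1) (d : chart Y n2).

Let pdom := cdom c `*` cdom d.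
Let pmap (z : X * Y) := row_mx (c z.1) (d z.2).
Let pinv (u : 'rV[R]_(n1 + n2)) := (cinv c (lsubmx u), cinv d (rsubmx u)).

Let pimgE : pmap @` pdom =
  (lsubmx @^-1` (c @` cdom c)) `&` (rsubmx @^-1` (d @` cdom d)).
Proof.
apply/seteqP; split=> [_ [z [/= cz dz] <-]|u [[x cx xu] [y dy yu]]].
  rewrite /pmap; split=> /=; first by rewrite row_mxKl; exists z.1.
  by rewrite row_mxKr; exists z.2.
by exists (x, y) => //; rewrite /pmap /= xu yu hsubmxK.
Qed.

Let open_pdom : open pdom.
Proof.
rewrite openE => -[x y] [/= cx dy]; exists (cdom c, cdom d) => //=.
by split; apply: open_nbhs_nbhs; split=> //; exact: open_cdom.
Qed.

Let open_pimg : open (pmap @` pdom).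
Proof.
rewrite pimgE; apply: openI; apply: open_comp; try exact: open_cimg.
  by move=> u _; exact: continuous_lsubmx.
by move=> u _; exact: continuous_rsubmx.
Qed.

Let pmapK z : pdom z -> pinv (pmap z) = z.
Proof.
by case: z => x y [/= cx dy]; rewrite /pinv /pmap row_mxKl row_mxKr !cmapK.
Qed.

Let pmap_cont z : pdom z -> {for z, continuous pmap}.
Proof.
move=> [cz dz]; apply: row_mx_cvg.
  by apply: continuous_comp; [exact: cvg_fst|exact: cmap_cont].
by apply: continuous_comp; [exact: cvg_snd|exact: cmap_cont].
Qed.

Let pinv_cont u : (pmap @` pdom) u -> {for u, continuous pinv}.
Proof.
rewrite pimgE => -[cu du].
have h1 : {for u, continuous (cinv c \o lsubmx)}.
  by apply: continuous_comp; [exact: continuous_lsubmx|exact: cinv_cont].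
have h2 : {for u, continuous (cinv d \o rsubmx)}.
  by apply: continuous_comp; [exact: continuous_rsubmx|exact: cinv_cont].
exact: cvg_pair h1 h2.
Qed.

Definition prod_chart : chart (X * Y)%type (n1 + n2) :=
  Chart open_pdom open_pimg pmapK pmap_cont pinv_cont.

End ProdChart.

Lemma prod_transition (X Y : topologicalType) n1 n2 (c c' : chart X n1)
    (d d' : chart Y n2) :
  transition c c' -> transition d d' ->
  transition (prod_chart c d) (prod_chart c' d').
Proof.
move=> tc td k; set D := _ `&` _.
have oD : open D by apply: openI; exact: open_cdom.
apply: (@Ck_prod _ n1 n2 n1 n2 k (c @` (cdom c `&` cdom c'))
  (d @` (cdom d `&` cdom d')) _ (c' \o cinv c) (d' \o cinv d)).
- by apply: chart_open => // z [].
- move=> _ [z [[cz dz] [cz' dz']] <-] /=; rewrite row_mxKl row_mxKr.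
  by split; [exists z.1|exists z.2].
- exact: tc.
- exact: td.
Qed.

End Chart.

(* [chart_at x] is a preferred chart around [x]; it identifies the tangent space
   T_x M with the row vectors 'rV_n.  Another chart c around x sees
   the tangent vector v as [v *m dchart c x]. *)
Record manifold (R : realType) (n : nat) := Manifold {
  carrier :> topologicalType;
  atlas : set (@chart R carrier n);
  chart_at : carrier -> @chart R carrier n;
  mfd_hausdorff : hausdorff_space carrier;
  mfd_countable : @second_countable carrier;
  atlas_compat : forall c d, atlas c -> atlas d -> transition c d;
  chart_at_atlas : forall x, atlas (chart_at x);
  chart_at_dom : forall x, cdom (chart_at x) x }.

Section ProdManifold.
Context {R : realType} (q m : nat) (T : manifold R q) (B : manifold R m).

Let prod_atlas : set (@chart R (T * B)%type (q + m)) :=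
  [set e | exists c d, [/\ atlas c, atlas d & e = prod_chart c d]].

Let prod_chart_at (z : T * B) := prod_chart (chart_at z.1) (chart_at z.2).

Let prod_hausdorff : hausdorff_space (T * B)%type.
Proof.
have := @mfd_hausdorff _ _ T; have := @mfd_hausdorff _ _ B.
rewrite !open_hausdorff => hB hT [x y] [x' y'] xy.
have [xx|xx] := eqVneq x x'.
  have yy : y != y' by apply: contra_neq xy => ->; rewrite xx.
  have [[U V] [/= Uy Vy] [/= oU oV UV]] := hB _ _ yy.
  exists (snd @^-1` U, snd @^-1` V) => /=.
    by rewrite !inE in Uy Vy *.
  split; [apply: open_comp => // z _; exact: cvg_snd|
          apply: open_comp => // z _; exact: cvg_snd|].
  by rewrite -preimage_setI (eqP UV) preimage_set0.
have [[U V] [/= Ux Vx] [/= oU oV UV]] := hT _ _ xx.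
exists (fst @^-1` U, fst @^-1` V) => /=.
  by rewrite !inE in Ux Vx *.
split; [apply: open_comp => // z _; exact: cvg_fst|
        apply: open_comp => // z _; exact: cvg_fst|].
by rewrite -preimage_setI (eqP UV) preimage_set0.
Qed.

Let prod_countable : @second_countable (T * B)%type.
Proof.
have [BT cT [oT bT]] := @mfd_countable _ _ T.
have [BB cB [oB bB]] := @mfd_countable _ _ B.
exists [set UV.1 `*` UV.2 | UV in BT `*` BB].
  exact: sub_countable (card_image_le _ _) (countableX cT cB).
split.
  move=> _ [[U V] [/= BU BV] <-]; rewrite openE => -[x y] [/= Ux Vy].
  by exists (U, V) => //=; split; apply: open_nbhs_nbhs; split=> //; [exact: oT|exact: oB].
move=> [x y] W [[P Q] /= [Px Qy] PQ].
have [U [BU Ux] UP] := bT x _ Px; have [V [BV Vy] VQ] := bB y _ Qy.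
exists (U `*` V); first by split=> //; exists (U, V).
by move=> z [/= Uz Vz]; apply: PQ; split; [exact: UP|exact: VQ].
Qed.

Let prod_compat e e' : prod_atlas e -> prod_atlas e' -> transition e e'.
Proof.
by move=> [c [d [ac ad ->]]] [c' [d' [ac' ad' ->]]]; apply: prod_transition;
  exact: atlas_compat.
Qed.

Let prod_chart_at_atlas z : prod_atlas (prod_chart_at z).
Proof. by exists (chart_at z.1), (chart_at z.2); split=> //; exact: chart_at_atlas. Qed.

Let prod_chart_at_dom z : cdom (prod_chart_at z) z.
Proof. by split; exact: chart_at_dom. Qed.

Definition prod_manifold : manifold R (q + m) :=
  Manifold prod_hausdorff prod_countable prod_compat
    prod_chart_at_atlas prod_chart_at_dom.

End ProdManifold.

Section Calculus.
Context {R : realType}.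

Definition smooth_fun n (M : manifold R n) (V : normedModType R)
    (U : set M) (f : M -> V) :=
  forall c, atlas c -> Coo (c @` (cdom c `&` U)) (f \o cinv c).

Definition smooth_map n k (M : manifold R n) (N : manifold R k)
    (U : set M) (F : M -> N) :=
  (forall x, U x -> {for x, continuous F}) /\
  forall c d, atlas c -> atlas d ->
    Coo (c @` (cdom c `&` U `&` F @^-1` cdom d)) (d \o F \o cinv c).

Definition local_diffeo n k (M : manifold R n) (N : manifold R k) (F : M -> N) :=
  forall x, exists (U : set M) (s : N -> M),
    [/\ open U /\ U x, smooth_map U F, open (F @` U),
        smooth_map (F @` U) s & forall y, U y -> s (F y) = y].

(* 'J is the matrix of the differential, acting on row vectors from the right.
   [dchart c x] is the differential T_x M -> 'rV_n of the chart c at x. *)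
Definition dchart n (M : manifold R n) (c : chart M n) (x : M) : 'M[R]_n :=
  'J (c \o cinv (chart_at x)) (chart_at x x).

Definition tangent_map n k (M : manifold R n) (N : manifold R k)
    (F : M -> N) (x : M) : 'M[R]_(n, k) :=
  'J (chart_at (F x) \o F \o cinv (chart_at x)) (chart_at x x).

(* (0,2)-tensor fields: [h x] is the Gram matrix of a bilinear form on T_x M. *)
Definition tensor n (M : manifold R n) := M -> 'M[R]_n.

Definition form n (b : 'M[R]_n) (v w : 'rV[R]_n) : R := (v *m b *m w^T) 0 0.

Definition pullback n k (M : manifold R n) (N : manifold R k)
    (F : M -> N) (h : tensor N) : tensor M :=
  fun x => tangent_map F x *m h (F x) *m (tangent_map F x)^T.

Definition immersion n k (M : manifold R n) (N : manifold R k) (F : M -> N) :=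
  smooth_map setT F /\ forall x, row_free (tangent_map F x).

(* The rows of X are k vector fields on M. *)
Definition smooth_fields n k (M : manifold R n) (U : set M) (X : M -> 'M[R]_(k, n)) :=
  forall c, atlas c ->
    Coo (c @` (cdom c `&` U)) (fun u => X (cinv c u) *m dchart c (cinv c u)).

Definition subspaces n (M : manifold R n) := M -> set 'rV[R]_n.

Definition full_tangent n (M : manifold R n) : subspaces M := fun=> setT.

Definition subbundle n (M : manifold R n) (k : nat) (E : subspaces M) :=
  forall x, exists (U : set M) (X : M -> 'M[R]_(k, n)),
    [/\ open U /\ U x, smooth_fields U X &
        forall z, U z -> row_free (X z) /\ E z = [set v | (v <= X z)%MS]].

Definition radical n (M : manifold R n) (E : subspaces M) (g : tensor M) :
    subspaces M :=
  fun x => [set v | E x v /\ forall w, E x w -> form (g x) v w = 0].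

Definition negative_frame n (V : set 'rV[R]_n) (b : 'M[R]_n) s (W : 'M[R]_(s, n)) :=
  row_free W /\ forall v, (v <= W)%MS -> V v /\ (v != 0 -> form b v v < 0).

(* The index is the largest dimension of a subspace of V on which b is
   negative definite. *)
Definition has_index n (V : set 'rV[R]_n) (b : 'M[R]_n) (s : nat) :=
  (exists W : 'M[R]_(s, n), negative_frame V b W) /\
  forall s' (W : 'M[R]_(s', n)), negative_frame V b W -> (s' <= s)%N.

(* Only the restriction of g to E is constrained.  Smoothness as a section of
   E* (x) E* is tested on smooth local sections of E. *)
Definition metric_of_index n (M : manifold R n) k (E : subspaces M)
    (g : tensor M) (s : nat) :=
  [/\ subbundle k E,
      forall x v w, E x v -> E x w -> form (g x) v w = form (g x) w v,
      forall (U : set M) (X Y : M -> 'rV[R]_n),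
        open U -> smooth_fields U X -> smooth_fields U Y ->
        (forall x, U x -> E x (X x) /\ E x (Y x)) ->
        smooth_fun U (fun x => form (g x) (X x) (Y x)) &
      forall x, has_index (E x) (g x) s].

Definition bundle_metric n (M : manifold R n) k (E : subspaces M) (g : tensor M) :=
  exists s, metric_of_index k E g s.

Definition semi_riemannian n (M : manifold R n) (g : tensor M) :=
  (exists2 s, metric_of_index n (@full_tangent n M) g s & (1 <= s <= n.-1)%N) /\
  forall x v, radical (@full_tangent n M) g x v -> v = 0.

Definition lightlike_metric n (M : manifold R n) k (E : subspaces M)
    (r : nat) (g : tensor M) :=
  [/\ bundle_metric k E g, subbundle r (radical E g) & (1 <= r <= k)%N].

Definition lightlike_submanifold m l (B : manifold R m) (N : manifold R (m + l))
    (h : tensor N) (j : B -> N) (rho : nat) :=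
  [/\ immersion j, injective j,
      lightlike_metric m (@full_tangent m B) rho (pullback j h) &
      (1 <= rho <= minn m l)%N].

Definition isometry n (M : manifold R n) (g : tensor M) (F : M -> M) :=
  [/\ smooth_map setT F,
      exists F' : M -> M, [/\ smooth_map setT F', cancel F F' & cancel F' F] &
      forall x, pullback F g x = g x].

End Calculus.

Section FundamentalGroup.
Context (R : realType).

Lemma within_comp (X : topologicalType) (A B : set R) (phi : R -> R) (g : R -> X) :
  continuous phi -> (forall t, A t -> B (phi t)) ->
  {within B, continuous g} -> {within A, continuous (g \o phi)}.
Proof.
move=> cphi AB /subspace_continuousP cg; apply/subspace_continuousP => t At W Wt.
have := cphi t _ (cg _ (AB _ At) _ Wt); rewrite /= !nbhs_simpl /= /within /=.
by apply: filterS => s h /AB; exact: h.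
Qed.

Record loop (X : topologicalType) (x0 : X) := Loop {
  loop_fun :> R -> X;
  loop_cont : {within `[0, 1], continuous loop_fun};
  loop_0 : loop_fun 0 = x0;
  loop_1 : loop_fun 1 = x0 }.

Section LoopOps.
Context (X : topologicalType) (x0 : X).

Lemma loop_cst_cont : {within `[0, 1], continuous (fun _ : R => x0)}.
Proof. exact: cst_continuous. Qed.

Definition loop_cst : loop x0 := Loop loop_cst_cont erefl erefl.

Section Cat.
Context (gamma delta : loop x0).

Let cat (t : R) := if t <= 2^-1 then gamma (2 * t) else delta (2 * t - 1).

Let cat_cont : {within `[0, 1], continuous cat}.
Proof.
have -> : `[0, 1]%classic = `[0, 2^-1]%classic `|` `[2^-1, 1]%classic :> set R.
  apply/seteqP; split=> t /=; rewrite !in_itv /=.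
    move=> /andP[t0 t1]; have [th|th] := lerP t 2^-1; [left|right].
      by rewrite t0.
    by rewrite (ltW th).
  by case=> /andP[]; lra.
have cM : continuous (fun t : R => 2 * t).
  by move=> t; apply: cvgMr; exact: cvg_id.
have cA : continuous (fun t : R => 2 * t - 1).
  by move=> t; apply: cvgB; [exact: cM|exact: cvg_cst].
apply: withinU_continuous; try exact: interval_closed.
- have h (t : R) : `[0, 2^-1]%classic t -> `[0, 1]%classic (2 * t).
    by rewrite /= !in_itv /=; lra.
  move: (within_comp cM h (@loop_cont X x0 gamma)).
  apply: subspace_eq_continuous => t; rewrite inE /= in_itv /= => /andP[_ t1].
  by rewrite /from_subspace /cat t1.
- have h (t : R) : `[2^-1, 1]%classic t -> `[0, 1]%classic (2 * t - 1).
    by rewrite /= !in_itv /=; lra.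
  move: (within_comp cA h (@loop_cont X x0 delta)).
  apply: subspace_eq_continuous => t; rewrite inE /= in_itv /= => /andP[t1 _].
  rewrite /from_subspace /cat; have [th|//] := lerP t 2^-1.
  have -> : t = 2^-1 by lra.
  have e1 : 2 * 2^-1 = 1 :> R by rewrite divff ?pnatr_eq0.
  by rewrite -[LHS]/(delta (2 * 2^-1 - 1)) e1 subrr loop_0 loop_1.
Qed.

Let cat_0 : cat 0 = x0.
Proof. by rewrite /cat ifT ?mulr0 ?loop_0 //; lra. Qed.

Let cat_1 : cat 1 = x0.
Proof.
rewrite /cat ifF; last by apply/negbTE; rewrite -ltNge; lra.
by rewrite (_ : 2 * 1 - 1 = 1) ?loop_1 //; lra.
Qed.

Definition loop_cat : loop x0 := Loop cat_cont cat_0 cat_1.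
End Cat.

Section Rev.
Context (gamma : loop x0).

Let rev (t : R) := gamma (1 - t).

Let rev_cont : {within `[0, 1], continuous rev}.
Proof.
apply: (within_comp _ _ (@loop_cont X x0 gamma)) => [t|t].
  by apply: cvgB; [exact: cvg_cst|exact: cvg_id].
by rewrite /= !in_itv /=; lra.
Qed.

Let rev_0 : rev 0 = x0. Proof. by rewrite /rev subr0 loop_1. Qed.
Let rev_1 : rev 1 = x0. Proof. by rewrite /rev subrr loop_0. Qed.

Definition loop_rev : loop x0 := Loop rev_cont rev_0 rev_1.
End Rev.

Definition loop_homotopic (gamma delta : loop x0) :=
  exists H : R * R -> X,
    [/\ {within `[0, 1] `*` `[0, 1], continuous H},
        forall t, 0 <= t <= 1 -> H (0, t) = gamma t /\ H (1, t) = delta t &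
        forall s, 0 <= s <= 1 -> H (s, 0) = x0 /\ H (s, 1) = x0].

(* Homotopy classes of loops, as sets of loops *)
Definition fundamental_group := {A : set (loop x0) | exists gamma, A = loop_homotopic gamma}.

Definition loop_class (gamma : loop x0) : fundamental_group :=
  exist _ (loop_homotopic gamma) (ex_intro _ gamma erefl).

End LoopOps.

Definition path_connected (X : topologicalType) (A : set X) :=
  forall x y, A x -> A y -> exists c : R -> X,
    [/\ {within `[0, 1], continuous c}, c 0 = x, c 1 = y &
        forall t, 0 <= t <= 1 -> A (c t)].

Definition simply_connected (X : topologicalType) :=
  path_connected [set: X] /\
  forall (x : X) (gamma : loop x), loop_homotopic gamma (loop_cst x).

Definition evenly_covered (X Y : topologicalType) (p : X -> Y) (V : set Y) :=
  exists S : set (set X),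
    [/\ forall U, S U -> open U /\ set_bij U V p,
        trivIset S id & \bigcup_(U in S) U = p @^-1` V].

Definition universal_covering m (Bt B : manifold R m) (p : Bt -> B) :=
  [/\ local_diffeo p, range p = setT,
      forall b, exists V : set B, [/\ open V, V b & evenly_covered p V] &
      simply_connected Bt].

End FundamentalGroup.

Section Foliation.
Context {R : realType} (q m : nat) (M : manifold R (q + m)).

(* Charts of the maximal atlas *)
Definition smooth_chart (c : chart M (q + m)) :=
  forall d, atlas d -> transition c d /\ transition d c.

(* A foliation of codimension q is given by its set of leaves.  In coordinates,
   'rV_(q + m) is R^q x R^m: [lsubmx] are the transverse coordinates, which must
   be constant exactly on the connected components (the plaques) of the
   intersection of a leaf with the domain of the chart. *)
Definition foliated_chart (F : set (set M)) (c : chart M (q + m)) :=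
  smooth_chart c /\
  forall L x, F L -> L x -> cdom c x ->
    connected_component (L `&` cdom c) x =
    [set z | cdom c z /\ lsubmx (c z) = lsubmx (c x)].

(* Path-connectedness, rather than connectedness in the topology of M, is what
   makes a dense leaf connected in its own (finer) topology. *)
Definition foliation (F : set (set M)) :=
  [/\ forall x, exists2 L, F L & L x,
      forall L L', F L -> F L' -> L `&` L' !=set0 -> L = L',
      forall L, F L -> L !=set0 /\ path_connected R L &
      forall x, exists2 c, foliated_chart F c & cdom c x].

Definition leaf_tangent (F : set (set M)) : subspaces M :=
  fun x => [set v | exists c,
    [/\ foliated_chart F c, cdom c x & lsubmx (v *m dchart c x) = 0]].

Definition tangentially_lightlike (F : set (set M)) (g : tensor M) :=
  foliation F /\
  exists2 r, (1 <= r <= minn m q)%N & lightlike_metric m (leaf_tangent F) r g.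

End Foliation.

Section Suspension.
Context {R : realType} (q m : nat).
Context (T : manifold R q) (B Bt : manifold R m).

Definition warped_product (gT : tensor T) (gBt : tensor Bt) (f : T -> R) :
    tensor (prod_manifold T Bt) :=
  let P := prod_manifold T Bt in
  fun u => @pullback R (q + m) q P T fst gT u
           + f u.1 ^+ 2 *: @pullback R (q + m) m P Bt snd gBt u.

Context (p : Bt -> B) (x0 : B) (xt0 : Bt).

(* The right action of pi_1(B, x0) on the covering by deck transformations,
   relative to the base point xt0 over x0: xt0 . [gamma] is the starting point
   of the lift of gamma that ends at xt0. *)
Definition deck_action (act : Bt -> fundamental_group R x0 -> Bt) :=
  [/\ forall a, continuous (act ^~ a) /\ forall x, p (act x a) = p x,
      forall x, act x (loop_class (loop_cst R x0)) = x,
      forall x gamma delta, act x (loop_class (loop_cat gamma delta)) =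
        act (act x (loop_class gamma)) (loop_class delta) &
      forall (gamma : loop R x0) (lift : R -> Bt),
        {within `[0, 1], continuous lift} ->
        (forall t, 0 <= t <= 1 -> p (lift t) = gamma t) ->
        lift 1 = xt0 -> lift 0 = act xt0 (loop_class gamma)].

(* Multiplicativity is stated on representatives; this is a homomorphism since
   the product in pi_1 is [gamma][delta] = [gamma delta]. *)
Definition isometric_rep (gT : tensor T) (phi : fundamental_group R x0 -> T -> T) :=
  (forall a, isometry gT (phi a)) /\
  forall gamma delta, phi (loop_class (loop_cat gamma delta)) =
    phi (loop_class gamma) \o phi (loop_class delta).

Definition diagonal_action (phi : fundamental_group R x0 -> T -> T) (act : Bt -> fundamental_group R x0 -> Bt)
    (gamma : loop R x0) (u : T * Bt) : T * Bt :=
  (phi (loop_class (loop_rev gamma)) u.1, act u.2 (loop_class gamma)).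

(* These conditions determine (M, pr) up to a unique diffeomorphism: M is the
   orbit space, with the manifold structure that makes pr etale. *)
Definition quotient_manifold (phi : fundamental_group R x0 -> T -> T)
    (act : Bt -> fundamental_group R x0 -> Bt) (M : manifold R (q + m))
    (pr : prod_manifold T Bt -> M) :=
  [/\ local_diffeo pr, range pr = setT &
      forall u v, pr u = pr v <-> exists gamma, v = diagonal_action phi act gamma u].

Definition suspension (M : manifold R (q + m)) (pr : prod_manifold T Bt -> M) :
    set (set M) :=
  [set pr @` ([set y] `*` setT) | y in setT].

End Suspension.

(* Main.v *)
From HB Require Import structures.
Require Import Defs.
From mathcomp Require Import ring lra lebesgue_measure.
Set Implicit Arguments.
Unset Strict Implicit.
Unset Printing Implicit Defensive.
Import Order.TTheory GRing.Theory Num.Theory.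
Import numFieldTopology.Exports numFieldNormedType.Exports.
Local Open Scope classical_set_scope.
Local Open Scope ring_scope.

(** Everything is local and happens in one kind of chart.  Around a point
    [pr (y0, b0)] of [M], compose a local inverse of the etale map [pr] with
    [prod_chart a (d \o p)], where [a] is a chart of [T] around [y0] and [d] a
    chart of [B] around [p b0]; shrink the domain so that the image is a ball.

    - Foliation.  Two points of the product with the same image in [M] differ by
      an element of the fundamental group, which acts diagonally; so leaves that
      meet coincide ([suspension_leafE]).  In the chart above, a leaf is a union of
      slices with [lsubmx] constant, each connected because it is a slice of a
      ball.  To see that the slices are the components of the trace of the leaf, it
      suffices that only countably many of them occur, since a countable connected
      set of reals is a point.  They are countably many because distinct slices
      give distinct points of one fibre of [pr], which is discrete in a second
      countable space ([leaf_transverse_countable], [foliated_product_chart]).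

    - Tangent spaces.  [leaf_tangent] is defined through some foliated chart;
      by [foliated_transition_vertical] the transition between two foliated charts
      preserves the vertical directions, so any foliated chart computes it
      ([leaf_tangentE]).

    - Metric.  In the chart above, [pr], [p] and the two projections of the
      product become the identity or linear projections, so the chain rule
      gives an isomorphism of T_(p b) B with the tangent space of the leaf at
      [pr (y, b)], under which [g] is [f y ^+ 2] times the metric of [B]
      ([leaf_frame], [leaf_frame_gram], [adapted_chart]).  Such a conformal
      isomorphism preserves the index and carries radical to radical; reading a local
      frame of the radical of [B] in the chart gives a smooth local frame of
      the radical of the leaf metric ([suspension_lightlike]).

    The calculus behind this is the closure of C^k maps under composition and
    the resulting chain rule in arbitrary charts of the maximal atlas
    ([Ck_comp], [smooth_in_charts], [jacobian_charts]). *)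

(** * Maps of class C^k *)

Section SmoothCalculus.
Context {R : realType}.
Implicit Types V W : normedModType R.

Lemma Ck_sub V W k (A D : set V) (f : V -> W) : A `<=` D -> Ck k D f -> Ck k A f.
Proof.
move=> AD; elim: k f => [|k IH] f /=; first by move=> cf x /AD; exact: cf.
by move=> [df Df]; split=> [x /AD|v]; [exact: df|exact: IH].
Qed.

Lemma Ck_local V W k (D : set V) (f : V -> W) :
  (forall x, D x -> exists2 A, A x & Ck k A f) -> Ck k D f.
Proof.
elim: k f => [|k IH] f loc /=; first by move=> x /loc[A Ax]; apply.
split=> [x /loc[A Ax [df _]]|v]; first exact: df.
by apply: IH => x /loc[A Ax [_ Df]]; exists A => //; exact: Df.
Qed.

Lemma CkW V W k (D : set V) (f : V -> W) : Ck k.+1 D f -> Ck k D f.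
Proof.
elim: k f => [|k IH] f [df Df]; first by move=> x /df; exact: differentiable_continuous.
by split=> // v; exact: IH.
Qed.

Lemma Ck_cst V W k (D : set V) (w : W) : Ck k D (fun=> w).
Proof.
elim: k w => [|k IH] w /=; first by move=> x _; exact: cst_continuous.
split=> [x _|v]; first exact: differentiable_cst.
rewrite (_ : (fun x => _) = fun=> 0); first exact: IH.
by apply/funext => x; rewrite (diff_cst w x).
Qed.

Lemma Ck_lin V W k (D : set V) (L : {linear V -> W}) : continuous L -> Ck k D L.
Proof.
move=> cL; case: k => [|k] /=; first by move=> x _; exact: cL.
split=> [x _|v]; first exact: linear_differentiable.
rewrite (_ : (fun x => _) = fun=> L v); first exact: Ck_cst.
by apply/funext => x; rewrite diff_lin.
Qed.

Lemma Ck_lin_comp V W (Z : normedModType R) k (D : set V) (L : {linear W -> Z}) (f : V -> W) :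
  open D -> continuous L -> Ck k D f -> Ck k D (L \o f).
Proof.
move=> oD cL; elim: k f => [|k IH] f /=.
  by move=> cf x /cf cfx; apply: continuous_comp => //; exact: cL.
move=> [df Df]; have dL y : differentiable L y by exact: linear_differentiable.
split=> [x /df dfx|v]; first exact: differentiable_comp.
apply: Ck_ext (IH _ (Df v)) => // x /df dfx.
by rewrite diff_comp //= diff_lin.
Qed.

Lemma CkD V W k (D : set V) (f g : V -> W) :
  open D -> Ck k D f -> Ck k D g -> Ck k D (fun x => f x + g x).
Proof.
move=> oD; elim: k f g => [|k IH] f g /=.
  by move=> cf cg x Dx; apply: cvgD; [exact: cf|exact: cg].
move=> [df Df] [dg Dg]; split=> [x Dx|v].
  by apply: differentiableD; [exact: df|exact: dg].
apply: Ck_ext (IH _ _ (Df v) (Dg v)) => // x Dx.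
have e := diffD (df x Dx) (dg x Dx).
exact: esym (congr1 (fun F : V -> W => F v) e).
Qed.

Lemma Ck_sum V W (I : finType) k (D : set V) (f : I -> V -> W) :
  open D -> (forall i, Ck k D (f i)) -> Ck k D (fun x => \sum_i f i x).
Proof.
move=> oD cf; rewrite -[f]/(fun i => f i); elim: (index_enum I) => [|i s IH].
  by rewrite (_ : (fun x => _) = fun=> 0); [exact: Ck_cst|
    apply/funext => x; rewrite big_nil].
rewrite (_ : (fun x => _) = fun x => f i x + \sum_(j <- s) f j x); first exact: CkD.
by apply/funext => x; rewrite big_cons.
Qed.

Lemma CkM V k (D : set V) (f g : V -> R) :
  open D -> Ck k D f -> Ck k D g -> Ck k D (fun x => f x * g x).
Proof.
move=> oD; elim: k f g => [|k IH] f g.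
  by move=> cf cg x Dx; apply: cvgM; [exact: cf|exact: cg].
move=> cf cg; have [df Df] := cf; have [dg Dg] := cg; split=> [x Dx|v].
  by apply: differentiableM; [exact: df|exact: dg].
apply: Ck_ext (CkD oD (IH _ _ (CkW cf) (Dg v)) (IH _ _ (CkW cg) (Df v))) => // x Dx.
have e := diffM (df x Dx) (dg x Dx).
exact: esym (congr1 (fun F : V -> R => F v) e).
Qed.

Lemma Ck_coord V a b k (D : set V) (f : V -> 'M[R]_(a, b)) i j :
  open D -> Ck k D f -> Ck k D (fun x => f x i j).
Proof.
move=> oD cf.
have linc : linear (fun M : 'M[R]_(a, b) => M i j) by move=> t u v; rewrite !mxE.
pose L : {linear 'M[R]_(a, b) -> R} :=
  HB.pack (fun M : 'M[R]_(a, b) => M i j) (GRing.isLinear.Build _ _ _ _ _ linc).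
by apply: (@Ck_lin_comp _ _ _ k D L f) => //; exact: coord_continuous.
Qed.

(** Conversely to [Ck_coord]; together they reduce matrix-valued maps to
    real-valued ones, for which products and their differentials are available. *)
Lemma Ck_mx V a b k (D : set V) (f : V -> 'M[R]_(a, b)) :
  open D -> (forall i j, Ck k D (fun x => f x i j)) -> Ck k D f.
Proof.
move=> oD cf.
rewrite (_ : f = fun x => \sum_i \sum_j f x i j *: delta_mx i j); last first.
  by apply/funext => x; exact: matrix_sum_delta.
apply: Ck_sum => // i; apply: Ck_sum => // j.
have linc : linear (fun t : R => t *: (delta_mx i j : 'M[R]_(a, b))).
  by move=> t u v; rewrite scalerDl scalerA.
pose L : {linear R -> 'M[R]_(a, b)} :=
  HB.pack (fun t : R => t *: (delta_mx i j : 'M[R]_(a, b)))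
    (GRing.isLinear.Build _ _ _ _ _ linc).
apply: (@Ck_lin_comp _ _ _ k D L (fun x => f x i j)) => //.
exact: scalel_continuous.
Qed.

Lemma Ck_mulmx V a b c k (D : set V) (f : V -> 'M[R]_(a, b)) (g : V -> 'M[R]_(b, c)) :
  open D -> Ck k D f -> Ck k D g -> Ck k D (fun x => f x *m g x).
Proof.
move=> oD cf cg; apply: Ck_mx => // i j.
rewrite (_ : (fun x => _) = fun x => \sum_s f x i s * g x s j); last first.
  by apply/funext => x; rewrite mxE.
by apply: Ck_sum => // s; apply: CkM => //; exact: Ck_coord.
Qed.

(** Induction on [k]: the directional derivative of [g \o f] along [v] is the sum
    over [i] of ('d f x v)_i times the [i]-th partial derivative of [g] at [f x],
    where each partial derivative composed with [f] is covered by the induction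
    hypothesis. *)
Lemma Ck_comp_fun V n k (A : set V) (D : set 'rV[R]_n) (f : V -> 'rV[R]_n)
    (g : 'rV[R]_n -> R) :
  open A -> (forall x, A x -> D (f x)) -> Ck k A f -> Ck k D g -> Ck k A (g \o f).
Proof.
move=> oA AD; elim: k g => [|k IH] g cf cg.
  by move=> x Ax; apply: continuous_comp; [exact: cf|apply: cg; exact: AD].
have [df Df] := cf; have [dg Dg] := cg; split=> [x Ax|v].
  by apply: differentiable_comp; [exact: df|apply: dg; exact: AD].
pose h x := \sum_i ('d f x v) 0 i * 'd g (f x) (delta_mx 0 i).
have ch : Ck k A h.
  apply: Ck_sum => // i; apply: CkM => //.
    exact: Ck_coord oA (Df v).
  exact: IH (fun y => 'd g y (delta_mx 0 i)) (CkW cf) (Dg _).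
apply: Ck_ext ch => // x Ax.
rewrite diff_comp /=; [|exact: df|apply: dg; exact: AD].
rewrite /h [in RHS](row_sum_delta ('d f x v)) linear_sum.
by apply: eq_bigr => i _; rewrite linearZ.
Qed.

Lemma Ck_comp V n a b k (A : set V) (D : set 'rV[R]_n) (f : V -> 'rV[R]_n)
    (g : 'rV[R]_n -> 'M[R]_(a, b)) :
  open A -> open D -> (forall x, A x -> D (f x)) -> Ck k A f -> Ck k D g ->
  Ck k A (g \o f).
Proof.
move=> oA oD AD cf cg; apply: Ck_mx => // i j.
by apply: (Ck_comp_fun oA AD cf (g := fun y => g y i j)); exact: Ck_coord.
Qed.

Lemma Coo_jacobian n a (D : set 'rV[R]_n) (f : 'rV[R]_n -> 'rV[R]_a) :
  open D -> Coo D f -> Coo D (fun x => 'J f x).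
Proof.
move=> oD cf k; apply: Ck_mx => // i j; have [_ /(_ (delta_mx 0 i)) Df] := cf k.+1.
rewrite (_ : (fun x => _) = fun x => ('d f x (delta_mx 0 i)) 0 j).
  exact: Ck_coord.
by apply/funext => x; rewrite mxE; congr ('d f x _ 0 j); apply/rowP => s; rewrite !mxE.
Qed.

Lemma jacobian_diff n a (f : 'rV[R]_n -> 'rV[R]_a) x v : 'd f x v = v *m 'J f x.
Proof. by rewrite mul_rV_lin1. Qed.

Lemma jacobian_comp n a b (f : 'rV[R]_n -> 'rV[R]_a) (g : 'rV[R]_a -> 'rV[R]_b) x y :
  f x = y -> differentiable f x -> differentiable g y ->
  'J (g \o f) x = 'J f x *m 'J g y.
Proof.
move=> <- df dg; apply/row_matrixP => i; rewrite !rowE mulmxA -!jacobian_diff.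
by rewrite diff_comp.
Qed.

Lemma jacobian_near n a (f g : 'rV[R]_n -> 'rV[R]_a) x :
  (\forall y \near x, f y = g y) -> differentiable f x -> 'J g x = 'J f x.
Proof.
have lin1 (F G : {linear 'rV[R]_n -> 'rV[R]_a}) : F = G :> (_ -> _) -> lin1_mx F = lin1_mx G.
  by move=> FG; apply/matrixP => i j; rewrite !mxE FG.
by move=> fg /(near_eq_diff fg)[_ /lin1].
Qed.

Lemma mulmxr_continuous n a (A : 'M[R]_(n, a)) : continuous (mulmxr A : 'rV[R]_n -> 'rV[R]_a).
Proof.
move=> x.
suff : Ck 0 setT (mulmxr A : 'rV[R]_n -> 'rV[R]_a) by move/(_ x I).
by apply: (Ck_mulmx openT); [move=> y _|exact: Ck_cst].
Qed.

Lemma Ck_mulmxr n a k (D : set 'rV[R]_n) (A : 'M[R]_(n, a)) :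
  Ck k D (fun v : 'rV[R]_n => v *m A).
Proof. exact: (@Ck_lin _ _ k D (mulmxr A)) (@mulmxr_continuous _ _ A). Qed.

Lemma jacobian_mulmxr n a (A : 'M[R]_(n, a)) x : 'J (fun v : 'rV[R]_n => v *m A) x = A.
Proof.
apply/row_matrixP => i; rewrite !rowE -!jacobian_diff.
by rewrite (diff_lin _ (@mulmxr_continuous _ _ A)).
Qed.

Lemma jacobian_id n x : 'J (id : 'rV[R]_n -> 'rV[R]_n) x = 1%:M.
Proof.
rewrite -[RHS](jacobian_mulmxr 1%:M x); congr (jacobian _ x).
by apply/funext => v; rewrite mulmx1.
Qed.

End SmoothCalculus.

(** * Charts of the maximal atlas *)

Section Charts.
Context {R : realType}.

(** Transition domains are of this form: [F] is continuous on [U] only. *)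
Lemma open_preimage_on (X Y : topologicalType) (U : set X) (V : set Y) (F : X -> Y) :
  open U -> (forall x, U x -> {for x, continuous F}) -> open V ->
  open (U `&` F @^-1` V).
Proof.
move=> oU cF oV; rewrite openE => x [Ux Vx]; apply: filterI.
  exact: open_nbhs_nbhs.
by apply: (cF x Ux); exact: open_nbhs_nbhs.
Qed.

Lemma open_image_sub (X Y : topologicalType) (U W : set X) (F : X -> Y) (s : Y -> X) :
  open W -> W `<=` U -> open (F @` U) ->
  (forall y, (F @` U) y -> {for y, continuous s}) -> (forall x, U x -> s (F x) = x) ->
  open (F @` W).
Proof.
move=> oW WU oFU cs sK; rewrite (_ : F @` W = F @` U `&` s @^-1` W).
  exact: open_preimage_on.
apply/seteqP; split=> [_ [x Wx <-]|_ [[x Ux <-] +]] /=.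
  by rewrite sK; [split=> //; exists x => //|]; exact: WU.
by rewrite /preimage /= sK// => Wx; exists x.
Qed.

(** A chart [e] of [X], cut down to an open set [W] on which [F] has a local inverse
    [s], becomes the chart [e \o s] of [Y].  This one construction restricts charts,
    pushes them along etale maps and (exchanging [F] and [s]) pulls them back. *)
Section PushChart.
Context (X Y : topologicalType) (n : nat) (e : @chart R X n) (W : set X).
Context (F : X -> Y) (s : Y -> X).
Hypothesis oW : open W.
Hypothesis We : W `<=` cdom e.
Hypothesis cF : forall x, W x -> {for x, continuous F}.
Hypothesis oFW : open (F @` W).
Hypothesis cs : forall y, (F @` W) y -> {for y, continuous s}.
Hypothesis sK : forall x, W x -> s (F x) = x.

Let pimgE : (e \o s) @` (F @` W) = e @` W.
Proof.
apply/seteqP; split=> [_ [_ [x Wx <-] <-]|_ [x Wx <-]].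
  by exists x => //=; rewrite sK.
by exists (F x); [exists x|rewrite /= sK].
Qed.

Let open_pimg : open ((e \o s) @` (F @` W)).
Proof. by rewrite pimgE; exact: chart_open. Qed.

Let pmapK y : (F @` W) y -> (F \o cinv e) ((e \o s) y) = y.
Proof. by move=> [x Wx <-] /=; rewrite sK// cmapK//; exact: We. Qed.

Let pmap_cont y : (F @` W) y -> {for y, continuous (e \o s)}.
Proof.
move=> Wy; apply: continuous_comp; first exact: cs.
by case: Wy => x Wx <-; rewrite sK//; apply: cmap_cont; exact: We.
Qed.

Let pinv_cont u : ((e \o s) @` (F @` W)) u -> {for u, continuous (F \o cinv e)}.
Proof.
rewrite pimgE => -[x Wx <-]; apply: continuous_comp.
  by apply: cinv_cont; exists x => //; exact: We.
by rewrite cmapK; [exact: cF|exact: We].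
Qed.

Definition push_chart : chart Y n := Chart oFW open_pimg pmapK pmap_cont pinv_cont.

End PushChart.

(** For a manifold of dimension [q + m] this is [smooth_chart]; factors of a
    product need the notion in any dimension. *)
Definition max_chart n (M : manifold R n) (c : @chart R M n) :=
  forall d, atlas d -> transition c d /\ transition d c.

Lemma atlas_max n (M : manifold R n) (c : @chart R M n) : atlas c -> max_chart c.
Proof. by move=> ac d ad; split; exact: atlas_compat. Qed.

Lemma chart_at_max n (M : manifold R n) (x : M) : max_chart (chart_at x).
Proof. exact/atlas_max/chart_at_atlas. Qed.

Lemma smooth_map_sub n k (M : manifold R n) (N : manifold R k) (U W : set M) (F : M -> N) :
  W `<=` U -> smooth_map U F -> smooth_map W F.
Proof.
move=> WU [cF dF]; split=> [x /WU|c d ac ad i]; first exact: cF.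
by apply: Ck_sub (dF c d ac ad i) => _ [x [[cx Wx] dx] <-]; exists x => //;
  split=> //; split=> //; exact: WU.
Qed.

Lemma smooth_map_id n (M : manifold R n) : smooth_map [set: M] (id : M -> M).
Proof.
split=> [x _|c d ac ad k]; first by move=> ?; exact.
by apply: Ck_sub (atlas_compat ac ad k) => _ [x [[cx _] dx] <-]; exists x.
Qed.

Section InCharts.
Context n k (M : manifold R n) (N : manifold R k) (U : set M) (F : M -> N).
Hypotheses (oU : open U) (sF : smooth_map U F).
Context (c : @chart R M n) (d : @chart R N k).

Lemma chart_domain_open : open (cdom c `&` U `&` F @^-1` cdom d).
Proof.
rewrite -setIA; apply: openI; first exact: open_cdom.
by apply: open_preimage_on => //; [exact: sF.1|exact: open_cdom].
Qed.

Hypotheses (mc : max_chart c) (md : max_chart d).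

(** [smooth_map] tests atlas charts only.  Near [c z], factor
    [d \o F \o cinv c] through the preferred charts at [z] and [F z]. *)
Lemma smooth_in_charts : Coo (c @` (cdom c `&` U `&` F @^-1` cdom d)) (d \o F \o cinv c).
Proof.
move=> i; apply: Ck_local => _ [z [[cz Uz] dz] <-].
pose c0 := chart_at z; pose d0 := chart_at (F z).
have [ac0 ad0] : atlas c0 /\ atlas d0 by split; exact: chart_at_atlas.
have [oc od] := (@open_cdom _ _ _ c, @open_cdom _ _ _ d).
pose S := cdom c `&` U `&` F @^-1` cdom d `&`
  (cdom c0 `&` U `&` F @^-1` cdom d0).
have oS : open S.
  apply: openI; first exact: chart_domain_open.
  rewrite -setIA; apply: openI; first exact: open_cdom.
  by apply: open_preimage_on => //; [exact: sF.1|exact: open_cdom].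
have oA : open (c @` S) by apply: chart_open => // x [[[]]].
have oB : open (c0 @` S) by apply: chart_open => // x [_ [[]]].
exists (c @` S).
  by exists z => //; split=> //; split=> //; [split=> //|]; exact: chart_at_dom.
have cS : Ck i (c @` S) (c0 \o cinv c).
  apply: Ck_sub ((mc ac0).1 i) => _ [x [[[cx _] _] [[c0x _] _]] <-].
  by exists x.
have c0S : Ck i (c0 @` S) (d0 \o F \o cinv c0).
  apply: Ck_sub (sF.2 _ _ ac0 ad0 i) => _ [x [_ xS] <-].
  by exists x.
have oD : open (d0 @` (cdom d0 `&` cdom d)).
  by apply: chart_open => [|x []//]; apply: openI => //; exact: open_cdom.
have step1 : Ck i (c0 @` S) ((d \o cinv d0) \o (d0 \o F \o cinv c0)).
  apply: Ck_comp c0S ((md ad0).2 i) => // _ [x [[[cx Ux] dx] [[c0x _] d0x]] <-] /=.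
  by rewrite cmapK//; exists (F x).
have := Ck_comp oA oB _ cS step1.
have mS : forall u, (c @` S) u -> (c0 @` S) ((c0 \o cinv c) u).
  by move=> _ [x Sx <-]; case: (Sx) => [[[cx Ux] dx] _] /=; rewrite cmapK//; exists x.
move=> /(_ mS); apply: Ck_ext => // _ [x [[[cx Ux] dx] [[c0x _] d0x]] <-] /=.
by rewrite !cmapK.
Qed.

Lemma smooth_chart_diff x : U x -> cdom c x -> cdom d (F x) ->
  differentiable (d \o F \o cinv c) (c x).
Proof.
by move=> Ux cx dx; have [+ _] := smooth_in_charts 1; apply; exists x.
Qed.

End InCharts.

(** The chain rule; the dictionary between [tangent_map], [dchart] and Jacobians in
    charts consists of its instances where one map is the identity. *)
Lemma jacobian_charts n k l (M : manifold R n) (N : manifold R k) (P : manifold R l)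
    (U : set M) (V : set N) (F : M -> N) (G : N -> P)
    (c : @chart R M n) (d : @chart R N k) (e : @chart R P l) x :
  open U -> open V -> smooth_map U F -> smooth_map V G ->
  max_chart c -> max_chart d -> max_chart e ->
  U x -> V (F x) -> cdom c x -> cdom d (F x) -> cdom e (G (F x)) ->
  'J (e \o (G \o F) \o cinv c) (c x) =
  'J (d \o F \o cinv c) (c x) *m 'J (e \o G \o cinv d) (d (F x)).
Proof.
move=> oU oV sF sG mc md me Ux Vx cx dx ex.
have df := smooth_chart_diff oU sF mc md Ux cx dx.
have dg := smooth_chart_diff oV sG md me Vx dx ex.
have fx : (d \o F \o cinv c) (c x) = d (F x) by rewrite /= cmapK.
apply: etrans (jacobian_comp fx df dg).
apply: jacobian_near; last by apply: differentiable_comp => //; rewrite fx.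
have oS := chart_domain_open oU sF c d.
have oA : open (c @` (cdom c `&` U `&` F @^-1` cdom d)).
  by apply: chart_open => // y [[]].
apply: filterS (open_nbhs_nbhs (conj oA _)); last by exists x.
by move=> _ [y [[cy Uy] dy] <-] /=; rewrite !cmapK.
Qed.

Lemma jacobian_chart_id n (M : manifold R n) (c : @chart R M n) x :
  cdom c x -> 'J (c \o cinv c) (c x) = 1%:M.
Proof.
move=> cx; rewrite -(jacobian_id (c x)); apply: jacobian_near => //.
have oA : open (c @` cdom c) by exact: open_cimg.
apply: filterS (open_nbhs_nbhs (conj oA _)); last by exists x.
by move=> _ [y cy <-] /=; rewrite cmapK.
Qed.

Lemma dchart_trans n (M : manifold R n) (c d : @chart R M n) x :
  max_chart c -> max_chart d -> cdom c x -> cdom d x ->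
  dchart d x = dchart c x *m 'J (d \o cinv c) (c x).
Proof.
move=> mc md cx dx; have sid := @smooth_map_id n M.
exact: (@jacobian_charts _ _ _ _ _ _ setT setT id id _ c d x openT openT sid sid
  (@chart_at_max _ M x) mc md I I (chart_at_dom x) cx dx).
Qed.

Lemma dchart_unit n (M : manifold R n) (c : @chart R M n) x :
  max_chart c -> cdom c x -> dchart c x \in unitmx.
Proof.
move=> mc cx; have c0x := @chart_at_dom _ _ M x.
have e : dchart (chart_at x) x = 1%:M := jacobian_chart_id c0x.
exact: (mulmx1_unit (etrans (esym (dchart_trans mc (@chart_at_max _ M x) cx c0x)) e)).1.
Qed.

Lemma tangent_map_charts n k (M : manifold R n) (N : manifold R k) (U : set M)
    (F : M -> N) (c : @chart R M n) (d : @chart R N k) x :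
  open U -> smooth_map U F -> max_chart c -> max_chart d ->
  U x -> cdom c x -> cdom d (F x) ->
  tangent_map F x *m dchart d (F x) = dchart c x *m 'J (d \o F \o cinv c) (c x).
Proof.
move=> oU sF mc md Ux cx dx.
have [m0 m0'] := (@chart_at_max _ M x, @chart_at_max _ N (F x)).
have [x0 x0'] := (@chart_at_dom _ _ M x, @chart_at_dom _ _ N (F x)).
transitivity ('J (d \o F \o cinv (chart_at x)) (chart_at x x)).
  exact/esym/(@jacobian_charts _ _ _ _ _ _ U setT F id _ _ d x oU openT sF
    (@smooth_map_id _ N) m0 m0' md Ux I x0 x0' dx).
exact: (@jacobian_charts _ _ _ _ _ _ setT U id F _ c d x openT oU
  (@smooth_map_id _ M) sF m0 mc md I Ux x0 cx dx).
Qed.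

(** In a second chart [d] the fields become [Y] times the Jacobian of the
    transition from [c] to [d], evaluated along the transition from [d] to [c]. *)
Lemma smooth_frame n k (M : manifold R n) (V : set M) (c : @chart R M n)
    (Y : 'rV[R]_n -> 'M[R]_(k, n)) :
  open V -> V `<=` cdom c -> max_chart c -> Coo (c @` V) Y ->
  smooth_fields V (fun z => Y (c z) *m invmx (dchart c z)).
Proof.
move=> oV Vc mc cY d ad i; have [tcd tdc] := mc _ ad.
have oDV : open (cdom d `&` V) by apply: openI => //; exact: open_cdom.
have oA : open (d @` (cdom d `&` V)) by apply: chart_open => // x [].
have oC : open (c @` (cdom d `&` V)) by apply: chart_open => // x [_ /Vc].
have tA : Ck i (d @` (cdom d `&` V)) (c \o cinv d).
  by apply: Ck_sub (tdc i) => _ [x [dx /Vc cx] <-]; exists x.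
have AC u : (d @` (cdom d `&` V)) u -> (c @` (cdom d `&` V)) ((c \o cinv d) u).
  by move=> [x [dx Vx] <-] /=; rewrite cmapK//; exists x.
have cYC : Ck i (c @` (cdom d `&` V)) Y.
  by apply: Ck_sub (cY i) => _ [x [dx Vx] <-]; exists x.
have cJ : Coo (c @` (cdom d `&` V)) (fun u => 'J (d \o cinv c) u).
  apply: Coo_jacobian => // k'; apply: Ck_sub (tcd k') => _ [x [dx /Vc cx] <-].
  by exists x.
have H := Ck_mulmx oA (Ck_comp oA oC AC tA cYC) (Ck_comp oA oC AC tA (cJ i)).
apply: (Ck_ext oA _ H) => _ [x [dx Vx] <-]; have cx := Vc _ Vx.
have ez : cinv d (d x) = x := cmapK dx.
have ed := dchart_trans mc (atlas_max ad) cx dx; have uc := dchart_unit mc cx.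
have e : Y (c x) *m 'J (d \o cinv c) (c x) = Y (c x) *m invmx (dchart c x) *m dchart d x.
  by rewrite -mulmxA ed mulKmx.
rewrite /comp ez.
exact: e.
Qed.

Lemma push_chart_max n (M N : manifold R n) (e : @chart R M n) (W : set M)
    (F : M -> N) (s : N -> M) (oW : open W) (We : W `<=` cdom e)
    (cF : forall x, W x -> {for x, continuous F}) (oFW : open (F @` W))
    (cs : forall y, (F @` W) y -> {for y, continuous s})
    (sK : forall x, W x -> s (F x) = x) :
  max_chart e -> smooth_map W F -> smooth_map (F @` W) s ->
  max_chart (push_chart oW We cF oFW cs sK).
Proof.
move=> me sF ss d ad; split=> i.
  apply: Ck_sub (smooth_in_charts oW sF me (atlas_max ad) i).
  move=> _ [_ [[x Wx <-] dx] <-] /=; rewrite sK//; exists x => //.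
  by split=> //; split=> //; exact: We.
apply: Ck_sub (smooth_in_charts oFW ss (atlas_max ad) me i).
move=> _ [y [dy Fy] <-] /=; case: (Fy) dy => x Wx <- dx.
exists (F x) => //; split; first by split=> //; exists x.
by rewrite /= sK//; exact: (We _ Wx).
Qed.

Section Product.
Context (q m : nat) (T : manifold R q) (B : manifold R m).
Let P := prod_manifold T B.

Lemma prod_chart_max (a : @chart R T q) (d : @chart R B m) :
  max_chart a -> max_chart d -> max_chart (prod_chart a d : chart P (q + m)).
Proof.
move=> ma md _ [a' [d' [aa' ad' ->]]].
have [t1 t2] := ma _ aa'; have [t3 t4] := md _ ad'.
by split; exact: prod_transition.
Qed.

Lemma lsubmx_Ck k (D : set 'rV[R]_(q + m)) : Ck k D (lsubmx : 'rV[R]_(q + m) -> 'rV[R]_q).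
Proof.
exact: (@Ck_lin _ _ _ k D (lsubmx : {linear 'rV[R]_(q + m) -> 'rV[R]_q})
  (@continuous_lsubmx R 1 q m)).
Qed.

Lemma rsubmx_Ck k (D : set 'rV[R]_(q + m)) : Ck k D (rsubmx : 'rV[R]_(q + m) -> 'rV[R]_m).
Proof.
exact: (@Ck_lin _ _ _ k D (rsubmx : {linear 'rV[R]_(q + m) -> 'rV[R]_m})
  (@continuous_rsubmx R 1 q m)).
Qed.

Lemma smooth_map_fst : smooth_map [set: P] (fst : P -> T).
Proof.
split=> [x _|_ d [a [b [aa ab ->]]] ad k]; first exact: cvg_fst.
set D := _ @` _.
have oD : open D.
  apply: chart_open => [|x [[? _] _]//]; rewrite setIT.
  apply: open_preimage_on; [exact: open_cdom|by move=> x _; exact: cvg_fst|exact: open_cdom].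
have oA : open (a @` (cdom a `&` cdom d)).
  by apply: chart_open => [|x []//]; apply: openI; exact: open_cdom.
apply: (Ck_comp oD oA _ (@lsubmx_Ck k D) (atlas_compat aa ad k)).
by move=> _ [x [[[ax bx] _] dx] <-] /=; rewrite row_mxKl; exists x.1.
Qed.

Lemma smooth_map_snd : smooth_map [set: P] (snd : P -> B).
Proof.
split=> [x _|_ d [a [b [aa ab ->]]] ad k]; first exact: cvg_snd.
set D := _ @` _.
have oD : open D.
  apply: chart_open => [|x [[? _] _]//]; rewrite setIT.
  apply: open_preimage_on; [exact: open_cdom|by move=> x _; exact: cvg_snd|exact: open_cdom].
have oA : open (b @` (cdom b `&` cdom d)).
  by apply: chart_open => [|x []//]; apply: openI; exact: open_cdom.
apply: (Ck_comp oD oA _ (@rsubmx_Ck k D) (atlas_compat ab ad k)).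
by move=> _ [x [[[ax bx] _] dx] <-] /=; rewrite row_mxKr; exists x.2.
Qed.

End Product.
End Charts.

(** * Connected and countable sets *)

Section Topology.
Context {R : realType}.

(** A convex set is the union of the segments from one of its points. *)
Lemma convex_connected (V : normedModType R) (A : set V) :
  (forall x y t, A x -> A y -> 0 <= t <= 1 -> A (x + t *: (y - x))) -> connected A.
Proof.
move=> cA; have [->|/set0P[x Ax]] := eqVneq A set0; first exact: connected0.
pose seg y : R -> V := fun t => x + t *: (y - x).
have -> : A = \bigcup_(y in A) (seg y @` `[0, 1]).
  apply/seteqP; split=> [y Ay|_ [y Ay [t t01 <-]]].
    exists y => //; exists 1; first by rewrite /= in_itv /= ler01 lexx.
    by rewrite /seg scale1r addrC subrK.
  by apply: cA => //; rewrite /= in_itv in t01.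
apply: bigcup_connected => [|y Ay].
  exists x => y Ay; exists 0; first by rewrite /= in_itv /= lexx ler01.
  by rewrite /seg scale0r addr0.
apply: connected_continuous_connected; first exact: segment_connected.
apply: continuous_subspaceT => t; apply: cvgD; first exact: cvg_cst.
exact: scalel_continuous.
Qed.

(** Otherwise it would contain a nondegenerate interval, of positive length but
    of measure zero. *)
Lemma countable_connected_subset1 (A : set R) :
  countable A -> connected A -> forall x y, A x -> A y -> x = y.
Proof.
move=> cA /connected_intervalP iA x y Ax Ay.
wlog xy : x y Ax Ay / x < y => [wl|].
  by case: (ltgtP x y) => // ?; [exact: wl|apply/esym/wl].
have : countable `[x, y].
  apply: sub_countable cA; apply: subset_card_le => z; rewrite /= in_itv /=.
  exact: iA.
move=> /(@countable_lebesgue_measure0 R); rewrite lebesgue_measure_itv /= lte_fin xy.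
by rewrite -EFinD => -[/eqP]; rewrite subr_eq0 gt_eqF.
Qed.

(** Choosing for each point of [A] a basic open set that isolates it is injective. *)
Lemma discrete_countable (X : topologicalType) (A : set X) :
  @second_countable X ->
  (forall x, A x -> exists2 U, open U /\ U x & forall y, A y -> U y -> y = x) ->
  countable A.
Proof.
move=> [BX cBX [_ bX]] dA; have [->|/set0P[x0 _]] := eqVneq A set0; first exact: countable0.
apply: sub_countable cBX.
apply: card_le_trans (card_image_le (fun b => xget x0 (A `&` b)) BX).
apply: subset_card_le => x Ax; have [U [oU Ux] Uuniq] := dA x Ax.
have [b [Bb bx] bU] := bX x U (open_nbhs_nbhs (conj oU Ux)).
exists b => //; apply: xget_unique => // y [Ay /bU Uy]; exact: Uuniq.
Qed.

Lemma path_connected_image (X Y : topologicalType) (A : set X) (F : X -> Y) :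
  continuous F -> path_connected R A -> path_connected R (F @` A).
Proof.
move=> cF pA _ _ [x Ax <-] [y Ay <-]; have [c [cc c0 c1 cA]] := pA x y Ax Ay.
exists (F \o c); split => [|||t t01] /=; rewrite ?c0 ?c1//; last first.
  by exists (c t) => //; exact: cA.
apply/subspace_continuousP => t t01.
move/subspace_continuousP : cc => /(_ t t01) ct.
by apply: cvg_comp ct _; exact: cF.
Qed.

End Topology.

(** * Tangent spaces of the leaves *)

Section LeafTangent.
Context {R : realType} (q m : nat) (M : manifold R (q + m)) (F : set (set M)).

Lemma lsubmx_continuous : continuous (lsubmx : 'rV[R]_(q + m) -> 'rV[R]_q).
Proof. exact: continuous_lsubmx. Qed.

Lemma convex_slice_connected (A : set 'rV[R]_(q + m)) (a : 'rV[R]_q) :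
  (forall x y t, A x -> A y -> 0 <= t <= 1 -> A (x + t *: (y - x))) ->
  connected (A `&` [set u | lsubmx u = a]).
Proof.
move=> cA; apply: convex_connected => x y t [Ax xa] [Ay ya] t01.
split; first exact: cA.
by move: xa ya => /= xa ya; rewrite linearD linearZ linearB /= xa ya subrr scaler0 addr0.
Qed.

Lemma ball_convex n (x0 : 'rV[R]_n) e (x y : 'rV[R]_n) t :
  ball x0 e x -> ball x0 e y -> 0 <= t <= 1 -> ball x0 e (x + t *: (y - x)).
Proof.
rewrite -!ball_normE /= => bx by_ /andP[t0 t1].
have -> : x0 - (x + t *: (y - x)) = (1 - t) *: (x0 - x) + t *: (x0 - y).
  by rewrite !scalerBr !scalerBl !scale1r; apply/rowP => i; rewrite !mxE; ring.
apply: le_lt_trans (ler_normD _ _) _; rewrite !normrZ.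
rewrite (ger0_norm t0) (ger0_norm (_ : 0 <= 1 - t)) ?subr_ge0//.
have [t0'|t0'] := eqVneq t 0; first by rewrite t0' subr0 mul1r mul0r addr0.
have tp : 0 < t by rewrite lt_def t0' t0.
by nra.
Qed.

(** The part of the plaque of [c] over a small ball around [c x] is connected, lies
    in the leaf and in [cdom c'], hence in the plaque of [c'] through [x].  So the
    transverse coordinates of [c'] are constant along that slice, and
    their derivative at [x] in vertical directions vanishes. *)
Lemma foliated_transition_vertical (c c' : chart M (q + m)) (x : M)
    (v : 'rV[R]_(q + m)) :
  (exists2 L, F L & L x) -> foliated_chart F c -> foliated_chart F c' ->
  cdom c x -> cdom c' x -> lsubmx v = 0 ->
  lsubmx (v *m 'J (c' \o cinv c) (c x)) = 0.
Proof.
move=> [L FL Lx] [mc fc] [mc' fc'] cx c'x v0.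
pose G := c' \o cinv c.
have dG : differentiable G (c x).
  exact: (@smooth_chart_diff _ _ _ _ _ setT id openT (@smooth_map_id _ _ M) c c' mc mc' x I cx c'x).
pose g : 'rV[R]_(q + m) -> 'rV[R]_q := lsubmx \o G.
have dl y : differentiable (lsubmx : 'rV[R]_(q + m) -> 'rV[R]_q) y by exact: differentiable_lsubmx.
have dg : differentiable g (c x) by exact: differentiable_comp.
have -> : lsubmx (v *m 'J G (c x)) = 'd g (c x) v.
  by rewrite diff_comp//= (diff_lin _ lsubmx_continuous) -jacobian_diff.
rewrite -deriveE//; apply: lim_near_cst; first exact: norm_hausdorff.
have oS : open (c @` (cdom c `&` cdom c')).
  by apply: chart_open => [|y []//]; apply: openI; exact: open_cdom.
have Sx : (c @` (cdom c `&` cdom c')) (c x) by exists x.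
have /nbhs_ballP[e /= e0 eS] := open_nbhs_nbhs (conj oS Sx).
pose P := ball (c x) e `&` [set u | lsubmx u = lsubmx (c x)].
have gP u : P u -> g u = g (c x).
  have cP : connected P by apply: convex_slice_connected => *; exact: ball_convex.
  have PS w : P w -> (c @` (cdom c `&` cdom c')) w by move=> [/eS].
  have cI : connected (cinv c @` P).
    apply: connected_continuous_connected => //; apply: continuous_in_subspaceT => w.
    rewrite inE => /PS[y [cy _] <-]; apply: cinv_cont; by exists y.
  have Px : P (c x) by split=> //; exact: ballxx.
  have xI : (cinv c @` P) x by exists (c x) => //; rewrite cmapK.
  have IL : cinv c @` P `<=` L `&` cdom c'.
    move=> _ [w Pw <-]; have [y [cy c'y] wE] := PS _ Pw.
    rewrite -wE cmapK//; split => //.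
    apply: (fun h => (@connected_component_sub _ (L `&` cdom c) x y h).1).
    by rewrite fc//=; split=> //; rewrite wE; case: Pw.
  move=> Pu; have := connected_component_max xI IL cI.
  rewrite fc'// => /(_ (cinv c u)) []; first by exists u.
  by move=> _ /= h; rewrite /g /G /= h cmapK.
have hv : (fun h : R => h *: v + c x) @ 0^' --> c x.
  rewrite -[X in _ --> X](_ : 0 *: v + c x = c x); last by rewrite scale0r add0r.
  apply: cvg_within_filter; apply: cvgD; last exact: cvg_cst.
  exact: scalel_continuous.
have nb := hv _ (nbhsx_ballx (c x) e e0).
near=> h.
have gh : g (h *: v + c x) = g (c x).
  apply: gP; split; first by near: h; exact: nb.
  by rewrite /= linearD linearZ /= v0 scaler0 add0r.
have e0' : h^-1 *: (g (h *: v + c x) - g (c x)) = 0 by rewrite gh subrr scaler0.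
exact: e0'.
Unshelve. all: by end_near. Qed.

Lemma leaf_tangentE (c : chart M (q + m)) (x : M) :
  (exists2 L, F L & L x) -> foliated_chart F c -> cdom c x ->
  leaf_tangent F x = [set v | lsubmx (v *m dchart c x) = 0].
Proof.
move=> Lx fc cx; apply/seteqP; split=> v; last by exists c.
move=> [c' [fc' c'x v0]] /=.
rewrite (dchart_trans fc'.1 fc.1 c'x cx) mulmxA.
exact: foliated_transition_vertical.
Qed.

End LeafTangent.

(** * Conformal pull-backs of bilinear forms *)

Section LinearAlgebra.
Context {R : realType} (m n : nat) (K : 'M[R]_(m, n)) (b : 'M[R]_n) (b' : 'M[R]_m) (a : R).
Hypotheses (freeK : row_free K) (a_gt0 : 0 < a) (bK : K *m b *m K^T = a *: b').

Lemma form_conformal w w' : form b (w *m K) (w' *m K) = a * form b' w w'.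
Proof.
rewrite /form trmx_mul !mulmxA -(mulmxA w) -(mulmxA w) bK.
by rewrite -scalemxAr -scalemxAl mxE.
Qed.

Lemma mulmx_free_eq0 (w : 'rV[R]_m) : (w *m K == 0) = (w == 0).
Proof.
apply/eqP/eqP => [|->]; last by rewrite mul0mx.
by rewrite -[X in _ = X](mul0mx _ K) => /(row_free_inj freeK).
Qed.

(** [w |-> w *m K] is a bijection onto [E] that multiplies the form by [a > 0], so
    negative definite subspaces correspond, with the same dimension. *)
Lemma has_index_conformal (E : set 'rV[R]_n) s :
  E = [set v | (v <= K)%MS] -> has_index setT b' s -> has_index E b s.
Proof.
move=> -> [[W [freeW negW]] maxs]; split=> [|s' W' [freeW' negW']].
  exists (W *m K); split; first by rewrite /row_free mxrankMfree.
  move=> v /submxP[u ->]; split; first by rewrite /= mulmxA submxMl.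
  rewrite mulmxA mulmx_free_eq0 => uW0; rewrite form_conformal pmulr_rlt0//.
  by have [_ /(_ uW0)] := negW (u *m W) (submxMl _ _).
have /submxP[W1 W1E] : (W' <= K)%MS.
  by apply/row_subP => i; have [] := negW' _ (row_sub i W').
apply: (maxs _ W1); split; first by move: freeW'; rewrite /row_free W1E mxrankMfree.
move=> v vW1; split=> [|v0]; first by [].
have vW' : (v *m K <= W')%MS by rewrite W1E submxMr.
have [_] := negW' _ vW'.
by rewrite mulmx_free_eq0 form_conformal => /(_ v0); rewrite pmulr_rlt0.
Qed.

Lemma radical_conformal r (X : 'M[R]_(r, m)) :
  (forall w, (forall w', form b' w w' = 0) <-> (w <= X)%MS) ->
  forall v, ((v <= K)%MS /\ forall w, (w <= K)%MS -> form b v w = 0) <-> (v <= X *m K)%MS.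
Proof.
move=> radX v; split=> [[/submxP[w ->] rad]|].
  apply: submxMr; apply/radX => w'; have := rad (w' *m K) (submxMl _ _).
  by rewrite form_conformal => /eqP; rewrite mulf_eq0 gt_eqF//= => /eqP.
move=> /submxP[u ->]; rewrite mulmxA; split; first exact: submxMl.
move=> _ /submxP[w' ->]; rewrite form_conformal (radX _).2 ?mulr0//.
exact: submxMl.
Qed.

End LinearAlgebra.

(** * The foliation of a suspension *)

Section Suspended.
Context {R : realType} (q m : nat) (T : manifold R q) (B Bt : manifold R m).
Let P := prod_manifold T Bt.
Context (p : Bt -> B) (xt0 : Bt) (M : manifold R (q + m)) (pr : P -> M).
Hypothesis p_etale : local_diffeo p.
Hypothesis pr_etale : local_diffeo pr.
Hypothesis leaves_match : forall (u v : P) b, pr u = pr v ->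
  exists b', pr (u.1, b) = pr (v.1, b').

Let F := suspension pr.

(** If [pr u] and [pr w] agree, [leaves_match] moves each point of one leaf to a
    point of the other. *)
Lemma suspension_leafE L u : F L -> L (pr u) -> L = pr @` ([set u.1] `*` setT).
Proof.
move=> [y _ <-] [w [wy _] wu]; rewrite /= in wy; subst y.
apply/seteqP; split=> _ [z [z1 _] <-] /=; rewrite /= in z1.
  have [b' e] := leaves_match z.2 wu.
  by exists (u.1, b') => //; rewrite -e -z1 -surjective_pairing.
have [b' e] := leaves_match z.2 (esym wu).
by exists (w.1, b') => //; rewrite -e -z1 -surjective_pairing.
Qed.

(** Sliding along the leaf moves every such [y'] over the point [xt0], that is, into
    the fibre of [pr] through [(y, xt0)]; the fibre is discrete since [pr]
    is locally injective. *)
Lemma leaf_transverse_countable y :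
  countable [set y' : T | exists b b', pr (y', b') = pr (y, b)].
Proof.
have cf : countable [set w | pr w = pr (y, xt0)].
  apply: discrete_countable (@mfd_countable _ _ P) _ => w /= wE.
  have [U [s [oUx _ _ _ sK]]] := pr_etale w.
  by exists U => // z /= zE Uz; rewrite -(sK _ Uz) zE -wE sK//; case: oUx.
apply: sub_countable cf.
apply: card_le_trans (card_image_le fst [set w | pr w = pr (y, xt0)]).
apply: subset_card_le => y' [b [b' e]]; have [b2 e2] := leaves_match xt0 (esym e).
by exists (y', b2).
Qed.

Lemma etale_continuous : continuous pr.
Proof. by move=> u; have [U [s [[_ Uu] [cU _] _ _ _]]] := pr_etale u; exact: cU. Qed.

Section AdaptedChart.
Context (y0 : T) (b0 : Bt) (V : set B).
Hypotheses (oV : open V) (Vb0 : V (p b0)).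

(** [d'] is [d \o p] near [b0]: with it, [p] is the identity in coordinates.  The
    set [V] lets the chart be chosen inside the domain of a local frame of [B]. *)
Lemma covering_chart : exists d d',
  [/\ atlas d, max_chart d', cdom d' b0 &
      forall b, cdom d' b -> [/\ V (p b), cdom d (p b), d' b = d (p b) &
        exists U, [/\ open U, U b, smooth_map U p & 'J (d \o p \o cinv d') (d' b) = 1%:M]]].
Proof.
have [U [s [[oU Ub0] sp opU ss sK]]] := p_etale b0.
pose d := chart_at (p b0); have ad : atlas d := chart_at_atlas _.
pose W := p @` U `&` (cdom d `&` V).
have oW : open W by apply: openI => //; apply: openI => //; exact: open_cdom.
have WpU : W `<=` p @` U by move=> ? [].
have Wd : W `<=` cdom d by move=> ? [_ []].
have sU : s @` (p @` U) = U.
  apply/seteqP; split=> [_ [_ [x Ux <-] <-]|x Ux]; first by rewrite sK.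
  by exists (p x); [exists x|exact: sK].
have pK x : W x -> p (s x) = x by move=> [[y Uy <-] _]; rewrite sK.
have sWU : s @` W `<=` U by move=> _ [_ [[y Uy <-] _] <-]; rewrite sK.
have cs x : W x -> {for x, continuous s} by move=> /WpU; exact: ss.1.
have cp y : (s @` W) y -> {for y, continuous p} by move=> /sWU; exact: sp.1.
have osW : open (s @` W).
  apply: (@open_image_sub _ _ (p @` U) W s p) => //.
  - by rewrite sU.
  - by rewrite sU => y; exact: sp.1.
  - by move=> _ [y Uy <-]; rewrite sK.
pose d' := push_chart oW Wd cs osW cp pK.
have md' : max_chart d'.
  apply: push_chart_max; first exact: atlas_max.
    exact: smooth_map_sub WpU ss.
  exact: smooth_map_sub sWU sp.
exists d, d'; split=> //.
  exists (p b0); last exact: sK.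
  by split; [exists b0|split=> //; exact: chart_at_dom].
move=> _ [x Wx <-]; rewrite pK//; case: (Wx) => -[y Uy yx] [dx Vx]; split=> //.
  by rewrite /= pK.
exists U; split=> //; first by rewrite -yx sK.
rewrite -(jacobian_id (d' (s x))); apply: jacobian_near => //.
have oA : open (d @` W) by exact: chart_open.
have Ax : (d @` W) (d' (s x)) by exists x => //=; rewrite pK.
apply: filterS (open_nbhs_nbhs (conj oA Ax)) => _ [z Wz <-] /=.
by rewrite cmapK ?pK//; exact: (Wd _ Wz).
Qed.

(** [c] is [prod_chart a d'] read through a local inverse of [pr], with a ball as
    image: convexity of the ball makes the plaques connected. *)
Lemma foliated_product_chart (a : @chart R T q) (d' : @chart R Bt m) :
  max_chart a -> max_chart d' -> cdom a y0 -> cdom d' b0 ->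
  let e := prod_chart a d' in
  exists c : @chart R M (q + m), [/\ foliated_chart F c, cdom c (pr (y0, b0)) &
    forall z, cdom c z -> exists u, [/\ pr u = z, cdom e u, c z = e u &
      exists U, [/\ open U, U u, smooth_map U pr & 'J (c \o pr \o cinv e) (e u) = 1%:M]]].
Proof.
move=> ma md' ay db e; have me : max_chart (e : @chart R P (q + m)) by exact: prod_chart_max.
have [U [s [[oU Uu0] sp opU ss sK]]] := pr_etale (y0, b0).
have e0 : cdom e (y0, b0) by [].
have oUe : open (U `&` cdom e) by apply: openI => //; exact: open_cdom.
have oe : open (e @` (U `&` cdom e)) by apply: chart_open => // ? [].
have ie : (e @` (U `&` cdom e)) (e (y0, b0)) by exists (y0, b0).
have /nbhs_ballP[eps /= eps0 epsP] := open_nbhs_nbhs (conj oe ie).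
pose bal := ball (e (y0, b0)) eps.
pose W := (U `&` cdom e) `&` e @^-1` bal.
have oW : open W.
  apply: open_preimage_on => //; last exact: ball_open.
  by move=> x [_ ex]; exact: cmap_cont.
have WU : W `<=` U by move=> ? [[]].
have We : W `<=` cdom e by move=> ? [[]].
have balE u : bal u -> exists2 w, W w & e w = u.
  by move=> bu; have [w Uw wu] := epsP _ bu; exists w => //; split=> //; rewrite /preimage /= wu.
have cpr x : W x -> {for x, continuous pr} by move=> /WU; exact: sp.1.
have prWU : pr @` W `<=` pr @` U by exact: image_subset.
have cs y : (pr @` W) y -> {for y, continuous s} by move=> /prWU; exact: ss.1.
have sKW x : W x -> s (pr x) = x by move=> /WU; exact: sK.
have opW : open (pr @` W) by apply: (@open_image_sub _ _ U W pr s) => //; exact: ss.1.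
pose c := push_chart oW We cpr opW cs sKW.
have mc : max_chart c.
  apply: push_chart_max => //; first exact: smooth_map_sub WU sp.
  exact: smooth_map_sub prWU ss.
have cE w : W w -> c (pr w) = e w by move=> Ww; rewrite /= sKW.
exists c; split.
- split=> // L x FL Lx cx; case: (cx) => u Wu uE; subst x.
  have LE := suspension_leafE FL Lx.
  apply/seteqP; split=> z.
    move=> [C [Cx CL Cc] Cz]; have [Lz cz] := CL _ Cz; split=> //.
    (* Each transverse coordinate maps the connected set C onto a countable one. *)
    apply/rowP => i; pose h (w : M) : R := c w 0 (lshift m i).
    have hE w : lsubmx (c w) 0 i = h w by rewrite mxE.
    rewrite !hE; apply: (@countable_connected_subset1 _ (h @` C)).
    + have := leaf_transverse_countable u.1.
      apply: sub_countable.
      apply: card_le_trans (card_image_le (fun y => a y 0 i) _).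
      apply: subset_card_le => _ [w Cw <-]; have [Lw [w' Ww' w'E]] := CL _ Cw.
      move: Lw; rewrite LE => -[w2 [w21 _] w2E].
      exists w'.1.
        by exists w2.2, w'.2; rewrite -w21 -!surjective_pairing w'E w2E.
      by rewrite /h -w'E cE//= mxE (unsplitK (inl _ i)).
    + apply: connected_continuous_connected => //.
      apply: continuous_in_subspaceT => w; rewrite inE => /CL[_ cw].
      by apply: (@continuous_comp _ _ _ c (fun v => v 0 (lshift m i)));
        [exact: cmap_cont|exact: coord_continuous].
    + by exists z.
    + by exists (pr u).
  move=> [cz zE]; have bc w : cdom c w -> bal (c w).
    by move=> [w' Ww' <-]; rewrite cE//; case: Ww'.
  (* Conversely the slice Q of the ball is carried by cinv c into the leaf. *)
  pose Q := bal `&` [set v | lsubmx v = lsubmx (c (pr u))].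
  have cQ : connected Q by apply: convex_slice_connected => *; exact: ball_convex.
  have QW v : Q v -> exists2 w, W w & e w = v by move=> [/balE].
  have cQc v : Q v -> (c @` cdom c) v.
    by move=> /QW[w Ww <-]; exists (pr w); [exists w|rewrite cE].
  exists (cinv c @` Q); last by exists (c z); [split=> //; exact: bc|rewrite cmapK].
  split.
  - by exists (c (pr u)); [split=> //; exact: bc|rewrite cmapK].
  - move=> _ [v Qv <-]; have [w Ww wv] := QW _ Qv; have ew := We _ Ww.
    have -> : cinv c v = pr w by rewrite -wv -cE// cmapK//; exists w.
    split; last by exists w.
    rewrite LE; exists w => //; split=> //=.
    have [_] := Qv; rewrite -wv cE//= !row_mxKl => /(congr1 (cinv a)).
    by rewrite !cmapK//; [case: (We _ Wu)|case: ew].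
  - apply: connected_continuous_connected => //.
    by apply: continuous_in_subspaceT => v; rewrite inE => /cQc; exact: cinv_cont.
- exists (y0, b0) => //; split=> //; exact: ballxx.
- move=> _ [u Wu <-]; exists u; split=> //; [exact: (We _ Wu)|exact: cE|].
  exists U; split=> //; first exact: WU.
  rewrite -(jacobian_id (e u)); apply: jacobian_near => //.
  have oA : open (e @` W) by exact: chart_open.
  apply: filterS (open_nbhs_nbhs (conj oA _)); last by exists u.
  move=> _ [w Ww <-]; have ew : cinv e (e w) = w := cmapK (We _ Ww).
  exact: etrans (esym (cE _ Ww)) (congr1 (c \o pr) (esym ew)).
Qed.

End AdaptedChart.
End Suspended.

(** * The metric along the leaves *)

Section ProductJacobians.
Context {R : realType} (q m : nat) (T : manifold R q) (B : manifold R m).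
Let P := prod_manifold T B.
Context (a : @chart R T q) (d : @chart R B m).
Let e : @chart R P (q + m) := prod_chart a d.

Lemma lsubmxE (v : 'rV[R]_(q + m)) : lsubmx v = v *m col_mx 1%:M 0.
Proof. by rewrite -[in RHS](hsubmxK v) mul_row_col mulmx1 mulmx0 addr0. Qed.

Lemma rsubmxE (v : 'rV[R]_(q + m)) : rsubmx v = v *m col_mx 0 1%:M.
Proof. by rewrite -[in RHS](hsubmxK v) mul_row_col mulmx1 mulmx0 add0r. Qed.

Lemma jacobian_fst u : cdom e u -> 'J (a \o (fst : P -> T) \o cinv e) (e u) = col_mx 1%:M 0.
Proof.
move=> eu; rewrite -[RHS](jacobian_mulmxr _ (e u)); apply: jacobian_near; last first.
  by have [+ _] := @Ck_mulmxr R _ _ 1 setT (col_mx 1%:M 0 : 'M[R]_(q + m, q)); apply.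
have oA : open (e @` cdom e) by exact: open_cimg.
apply: filterS (open_nbhs_nbhs (conj oA _)); last by exists u.
move=> _ [w ew <-]; rewrite -lsubmxE.
have we : cinv e (e w) = w := cmapK ew.
by apply: etrans (congr1 (fun z : P => a z.1) (esym we)); rewrite /= row_mxKl.
Qed.

Lemma jacobian_snd u : cdom e u -> 'J (d \o (snd : P -> B) \o cinv e) (e u) = col_mx 0 1%:M.
Proof.
move=> eu; rewrite -[RHS](jacobian_mulmxr _ (e u)); apply: jacobian_near; last first.
  by have [+ _] := @Ck_mulmxr R _ _ 1 setT (col_mx 0 1%:M : 'M[R]_(q + m, m)); apply.
have oA : open (e @` cdom e) by exact: open_cimg.
apply: filterS (open_nbhs_nbhs (conj oA _)); last by exists u.
move=> _ [w ew <-]; rewrite -rsubmxE.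
have we : cinv e (e w) = w := cmapK ew.
by apply: etrans (congr1 (fun z : P => d z.2) (esym we)); rewrite /= row_mxKr.
Qed.

End ProductJacobians.

Section LeafFrame.
Context {R : realType} (q m : nat).

(** With [Dd] and [Dc] the differentials of a chart of [B] and of a foliated chart of
    [M], the matrix of the isomorphism from the tangent space of [B] to that of the leaf
    which is the inclusion of the last [m] coordinates in these charts. *)
Definition leaf_frame (Dd : 'M[R]_m) (Dc : 'M[R]_(q + m)) : 'M[R]_(m, q + m) :=
  Dd *m row_mx 0 1%:M *m invmx Dc.

Lemma leaf_frame_span (Dd : 'M[R]_m) (Dc : 'M[R]_(q + m)) :
  Dd \in unitmx -> Dc \in unitmx ->
  row_free (leaf_frame Dd Dc) /\
  [set v : 'rV[R]_(q + m) | lsubmx (v *m Dc) = 0] = [set v | (v <= leaf_frame Dd Dc)%MS].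
Proof.
move=> ud uc; split.
  apply/row_freeP; exists (Dc *m col_mx 0 (invmx Dd)).
  rewrite /leaf_frame mulmxA mulmxKV// -mulmxA mul_row_col mulmx0 add0r mul1mx.
  exact: mulmxV.
apply/seteqP; split=> v /= => [v0|/submxP[w ->]].
  apply/submxP; exists (rsubmx (v *m Dc) *m invmx Dd).
  rewrite /leaf_frame !mulmxA mulmxKV// mul_mx_row mulmx0 mulmx1.
  by rewrite -[X in row_mx X _]v0 hsubmxK mulmxK.
by rewrite /leaf_frame !mulmxA mulmxKV// mul_mx_row mulmx0 row_mxKl.
Qed.

(** The linear algebra of the warped product at one point.  [A], [Pf], [Ps], [Pp]
    are the tangent maps of [pr], of the two projections and of [p]; [Dc], [De],
    [Da], [Dd'], [Dd] the differentials of the charts.  The leaf frame is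
    [X *m A], where [X] is the same frame in the product; [X] is killed by the
    first projection and is mapped to the identity by the second one followed by [p]. *)
Lemma leaf_frame_gram (A Dc De G : 'M[R]_(q + m)) (Da GT : 'M[R]_q) (Dd Dd' Pp GB : 'M[R]_m)
    (Pf : 'M[R]_(q + m, q)) (Ps : 'M[R]_(q + m, m)) (t : R) :
  Dc \in unitmx -> De \in unitmx -> Da \in unitmx -> Dd \in unitmx ->
  A *m Dc = De -> Pf *m Da = De *m col_mx 1%:M 0 -> Ps *m Dd' = De *m col_mx 0 1%:M ->
  Pp *m Dd = Dd' ->
  A *m G *m A^T = Pf *m GT *m Pf^T + t *: (Ps *m (Pp *m GB *m Pp^T) *m Ps^T) ->
  leaf_frame Dd Dc *m G *m (leaf_frame Dd Dc)^T = t *: GB.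
Proof.
move=> uc ue ua ud AE PfE PsE PpE GE.
pose X := leaf_frame Dd De.
have XA : X *m A = leaf_frame Dd Dc.
  by apply: (can_inj (mulmxK uc)); rewrite -mulmxA AE /X /leaf_frame !mulmxKV.
have XPf : X *m Pf = 0.
  apply: (can_inj (mulmxK ua)); rewrite -mulmxA PfE /X /leaf_frame mulmxA mulmxKV//.
  by rewrite -mulmxA mul_row_col mul0mx mulmx0 addr0 mulmx0 mul0mx.
have XPs : X *m Ps *m Pp = 1%:M.
  apply: (can_inj (mulmxK ud)); rewrite -(mulmxA _ Pp) PpE -(mulmxA X) PsE /X /leaf_frame mulmxA.
  by rewrite mulmxKV// -mulmxA mul_row_col mulmx0 add0r !mulmx1 mul1mx.
rewrite -XA trmx_mul mulmxA -(mulmxA X) -(mulmxA X) GE mulmxDr mulmxDl.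
rewrite !mulmxA XPf !mul0mx add0r -scalemxAr -scalemxAl !mulmxA XPs mul1mx.
by rewrite -!mulmxA -!trmx_mul XPs trmx1 mulmx1.
Qed.

End LeafFrame.

Section SuspendedMetric.
Context {R : realType} (q m : nat) (T : manifold R q) (B Bt : manifold R m).
Let P := prod_manifold T Bt.
Context (p : Bt -> B) (xt0 : Bt) (M : manifold R (q + m)) (pr : P -> M).
Hypothesis p_etale : local_diffeo p.
Hypothesis pr_etale : local_diffeo pr.
Hypothesis leaves_match : forall (u v : P) b, pr u = pr v ->
  exists b', pr (u.1, b) = pr (v.1, b').
Context (gT : tensor T) (gB : tensor B) (f : T -> R) (g : tensor M).
Hypothesis g_pullback : forall u, pullback pr g u = warped_product gT (pullback p gB) f u.

Let F := suspension pr.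

(** All that the study of the leaf metric uses: a foliated chart whose last [m]
    coordinates are a chart of [B], and in which the leaf metric is that of [B] up
    to the factor [f u.1 ^+ 2]. *)
Lemma adapted_chart (u0 : P) (V : set B) : open V -> V (p u0.2) ->
  exists (c : @chart R M (q + m)) (d : @chart R B m),
  [/\ foliated_chart F c, cdom c (pr u0), atlas d &
    forall z, cdom c z -> exists u : P,
      [/\ pr u = z, V (p u.2), cdom d (p u.2), d (p u.2) = rsubmx (c z) &
        leaf_frame (dchart d (p u.2)) (dchart c z) *m g z *m
          (leaf_frame (dchart d (p u.2)) (dchart c z))^T = f u.1 ^+ 2 *: gB (p u.2)]].
Proof.
case: u0 => y0 b0 oV /= Vb0.
have [d [d' [ad md' db0 dP]]] := covering_chart p_etale oV Vb0.
have [ma ay0] := (@chart_at_max _ _ T y0, @chart_at_dom _ _ T y0).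
have [c [fc cu0 cP]] := foliated_product_chart xt0 pr_etale leaves_match ma md' ay0 db0.
exists c, d; split=> // z cz; have [u [uz eu cE [U [oU Uu sU JU]]]] := cP z cz.
have [au du] := eu; have [Vu dpu d'E [U' [oU' Uu' sU' JU']]] := dP _ du.
exists u; split=> //; first by rewrite cE row_mxKr.
subst z; have md := atlas_max ad; have me := prod_chart_max ma md'.
have mc : max_chart c := fc.1.
have H1 := tangent_map_charts oU sU me mc Uu eu cz.
have H2 := tangent_map_charts openT (@smooth_map_fst _ _ _ T Bt) me ma I eu au.
have H3 := tangent_map_charts openT (@smooth_map_snd _ _ _ T Bt) me md' I eu du.
have H4 := tangent_map_charts oU' sU' md' md Uu' du dpu.
have J2 := jacobian_fst eu; have J3 := jacobian_snd eu.
have H1' := etrans H1 (etrans (congr1 (mulmx _) JU) (mulmx1 _)).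
have H2' := etrans H2 (congr1 (mulmx _) J2).
have H3' := etrans H3 (congr1 (mulmx _) J3).
have H4' := etrans H4 (etrans (congr1 (mulmx _) JU') (mulmx1 _)).
exact: leaf_frame_gram (dchart_unit mc cz) (dchart_unit me eu) (dchart_unit ma au)
  (dchart_unit md dpu) H1' H2' H3' H4' (g_pullback u).
Qed.

Lemma suspension_foliation : range pr = setT -> path_connected R [set: Bt] -> foliation F.
Proof.
move=> pr_onto pBt; split.
- move=> x; have [u _ <-] : range pr x by rewrite pr_onto.
  by exists (pr @` ([set u.1] `*` setT)); [exists u.1|exists u].
- move=> L L' FL FL' [x [Lx L'x]].
  have [u _ ux] : range pr x by rewrite pr_onto.
  rewrite -ux in Lx L'x.
  by rewrite (suspension_leafE leaves_match FL Lx) (suspension_leafE leaves_match FL' L'x).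
- move=> _ [y _ <-]; split; first by exists (pr (y, xt0)); exists (y, xt0).
  have -> : pr @` ([set y] `*` setT) = (fun b => pr (y, b)) @` setT.
    apply/seteqP; split=> [_ [[y' b] [/= -> _] <-]|_ [b _ <-]]; first by exists b.
    by exists (y, b).
  apply: path_connected_image => // b.
  apply: (@continuous_comp _ _ _ (fun b : Bt => (y, b)) pr); last exact: etale_continuous.
  by apply: cvg_pair; [exact: cvg_cst|exact: cvg_id].
- move=> x; have [u _ <-] : range pr x by rewrite pr_onto.
  by have [c [d [fc cu _ _]]] := adapted_chart openT (I : setT (p u.2)); exists c.
Qed.

Lemma suspension_lightlike rho :
  range pr = setT -> (forall y, 0 < f y) ->
  bundle_metric (q + m) (@full_tangent R (q + m) M) g ->
  lightlike_metric m (@full_tangent R m B) rho gB ->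
  lightlike_metric m (leaf_tangent F) rho g.
Proof.
move=> pr_onto f_gt0 [s [_ g_sym g_smooth _]] [[sB [_ _ _ gB_index]] gB_rad rho_m].
have covered x : exists2 L, F L & L x.
  have [u _ <-] : range pr x by rewrite pr_onto.
  by exists (pr @` ([set u.1] `*` setT)); [exists u.1|exists u].
have f2 y : 0 < f y ^+ 2 by rewrite exprn_gt0.
split=> //.
- exists sB; split.
  + move=> x; have [u _ ux] : range pr x by rewrite pr_onto.
    have [c [d [fc cu ad cP]]] := adapted_chart openT (I : setT (p u.2)).
    (* The coordinate fields along the plaques. *)
    pose Y (v : 'rV[R]_(q + m)) : 'M[R]_(m, q + m) := row_mx 0 1%:M.
    exists (cdom c), (fun z => Y (c z) *m invmx (dchart c z)); split.
    * by rewrite -ux; split=> //; exact: open_cdom.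
    * apply: smooth_frame => //; [exact: open_cdom|exact: fc.1|].
      by move=> k; exact: Ck_cst.
    * move=> z cz; have uc := dchart_unit fc.1 cz.
      have [rf sp] := leaf_frame_span (unitmx1 _ _) uc.
      rewrite /leaf_frame mul1mx in rf sp.
      by split=> //; rewrite (leaf_tangentE (covered z) fc cz).
  + by move=> x v w _ _; exact: g_sym.
  + by move=> U X Y oU sX sY _; exact: g_smooth.
  + move=> x; have [u _ ux] : range pr x by rewrite pr_onto.
    have [c [d [fc cu ad cP]]] := adapted_chart openT (I : setT (p u.2)).
    rewrite ux in cu; have [w [wx _ dw _ gram]] := cP _ cu.
    have [rf sp] := leaf_frame_span (dchart_unit (atlas_max ad) dw) (dchart_unit fc.1 cu).
    apply: (has_index_conformal rf (f2 _) gram _ (gB_index (p w.2))).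
    by rewrite (leaf_tangentE (covered x) fc cu).
- move=> x; have [u _ ux] : range pr x by rewrite pr_onto.
  have [V [X [[oV Vu] sX XP]]] := gB_rad (p u.2).
  have [c [d [fc cu ad cP]]] := adapted_chart oV Vu.
  (* Z is the frame X of the radical of B in the chart d; Y places it in the last m
     coordinates of c. *)
  pose Z (w : 'rV[R]_m) : 'M[R]_(rho, m) := X (cinv d w) *m dchart d (cinv d w).
  pose Y (v : 'rV[R]_(q + m)) : 'M[R]_(rho, q + m) := Z (rsubmx v) *m row_mx 0 1%:M.
  exists (cdom c), (fun z => Y (c z) *m invmx (dchart c z)); split.
  + by rewrite -ux; split=> //; exact: open_cdom.
  + apply: smooth_frame => //; [exact: open_cdom|exact: fc.1|].
    move=> k; have oc : open (c @` cdom c) by exact: open_cimg.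
    have od : open (d @` (cdom d `&` V)).
      by apply: chart_open => [|y []//]; apply: openI => //; exact: open_cdom.
    apply: Ck_mulmx => //; last exact: Ck_cst.
    apply: (Ck_comp oc od _ (@rsubmx_Ck _ _ _ k _) (sX d ad k)).
    by move=> _ [z cz <-]; have [w [_ Vw dw <- _]] := cP _ cz; exists (p w.2).
  + move=> z cz; have [w [wz Vw dw dwE gram]] := cP _ cz.
    have [rf sp] := leaf_frame_span (dchart_unit (atlas_max ad) dw) (dchart_unit fc.1 cz).
    have [rX radX] := XP _ Vw.
    have -> : Y (c z) *m invmx (dchart c z) =
        X (p w.2) *m leaf_frame (dchart d (p w.2)) (dchart c z).
      by rewrite /Y /Z -dwE cmapK// /leaf_frame !mulmxA.
    split; first by rewrite /row_free mxrankMfree.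
    have radX' v : (forall v', form (gB (p w.2)) v v' = 0) <-> (v <= X (p w.2))%MS.
      have e := congr1 (fun A : set 'rV[R]_m => A v) radX; rewrite /= in e.
      by rewrite -e; split=> [h|[_ h] v']; [split|exact: h].
    apply/seteqP; split=> v; rewrite /radical /= (leaf_tangentE (covered z) fc cz) sp /=.
      by move/(radical_conformal (f2 _) gram radX' v).
    by move/(radical_conformal (f2 _) gram radX' v).
Qed.

End SuspendedMetric.


(** * The suspension is tangentially lightlike *)

Theorem proposition3 (R : realType) (q m l rho : nat)
    (T : manifold R q) (gT : tensor T)
    (N : manifold R (m + l)) (h : tensor N)
    (B : manifold R m) (j : B -> N)
    (Bt : manifold R m) (p : Bt -> B) (x0 : B) (xt0 : Bt)
    (act : Bt -> fundamental_group R x0 -> Bt) (phi : fundamental_group R x0 -> T -> T) (f : T -> R)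
    (M : manifold R (q + m)) (pr : prod_manifold T Bt -> M) (g : tensor M)
    (T_connected : connected [set: T])
    (T_semi_riemannian : semi_riemannian gT)
    (N_semi_riemannian : semi_riemannian h)
    (B_connected : connected [set: B])
    (B_lightlike : lightlike_submanifold h j rho)
    (Bt_universal : universal_covering p)
    (xt0_over : p xt0 = x0)
    (act_deck : deck_action p xt0 act)
    (phi_isometric : isometric_rep gT phi)
    (f_smooth : smooth_fun [set: T] f)
    (f_pos : forall y, 0 < f y)
    (f_invariant : forall a y, f (phi a y) = f y)
    (M_quotient : quotient_manifold phi act pr)
    (g_metric : bundle_metric (q + m) (@full_tangent R (q + m) M) g)
    (g_pullback : forall u,
      pullback pr g u = warped_product gT (pullback p (pullback j h)) f u) :
  let F := suspension pr in
  [/\ foliation F,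
      lightlike_metric m (leaf_tangent F) rho g &
      (rho <= q)%N -> tangentially_lightlike F g].
Proof.
move=> F; have [p_etale _ _ [Bt_path _]] := Bt_universal.
have [pr_etale pr_onto pr_fibre] := M_quotient.
have [_ _ gB_lightlike /andP[rho_gt0 rho_le]] := B_lightlike.
have leaves_match (u v : prod_manifold T Bt) b : pr u = pr v ->
    exists b', pr (u.1, b) = pr (v.1, b').
  (* The diagonal action moves whole leaves: act all of the covering by gamma. *)
  move=> /pr_fibre[gamma ->]; exists (act b (loop_class gamma)).
  by apply/pr_fibre; exists gamma.
have folF : foliation F.
  exact: (suspension_foliation xt0 p_etale pr_etale leaves_match g_pullback).
have lightF : lightlike_metric m (leaf_tangent F) rho g.
  exact: (suspension_lightlike xt0 p_etale pr_etale leaves_match g_pullback).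
split=> // rho_q; split=> //; exists rho => //.
by rewrite rho_gt0 leq_min rho_q andbT; move: rho_le; rewrite leq_min => /andP[].
Qed.
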